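(* Consider the infinite rooted binary tree with the random sampling process of parameter $p\in(0,1)$ described in the context, and a threshold rule based on a nondecreasing sequence of integers $\{c_i\}$ for which there is a constant $K$ with $c_i\le c_{\lfloor i/2\rfloor}+K$ for all $i$. Then this threshold rule achieves an $O(1)$ competitive ratio in expectation with respect to coverage, i.e. $\sup_n E[\mathrm{Cover}^*_n/\mathrm{Cover}_n]<\infty$, as well as an $O(1)$ approximation to the expected coverage, i.e. $\sup_n E[\mathrm{Cover}^*_n]/E[\mathrm{Cover}_n]<\infty$.
   Context: The universe $X$ is the set of nodes of an infinite-depth rooted binary tree. A random node is generated as follows: start at the root; at each step, with probability $p$ stop and output the current node, and otherwise move to the left or right child with equal probability. Samples $x_1,x_2,\dots$ are i.i.d. random nodes. For a node $x$, $\mathcal{D}(x)$ is the set of nodes on the path from the root to $x$ (inclusive); $\mathcal{D}(S)=\bigcup_{x\in S}\mathcal{D}(x)$ and $\mathrm{Cover}(S)=|\mathcal{D}(S)|$. The threshold rule is $\mathcal{X}_0=X$, $\mathcal{X}_i=\{x:|\mathcal{D}(x)|\ge c_i\}$ for $i\ge1$; sample $x_t$ is selected iff $x_t\in\mathcal{X}_j$ where $j$ is the number of samples selected among $x_1,\dots,x_{t-1}$. Let $T_n$ be the index of the $n$-th selected sample, $S_n$ the $n$ selected samples, $\mathrm{Cover}_n=\mathrm{Cover}(S_n)$, $\mathrm{Cover}^*_n=\max\{\mathrm{Cover}(S):S\subseteq\{x_1,\dots,x_{T_n}\},|S|=n\}$. *)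

(* Defs.v *)
From HB Require Import structures.
From mathcomp Require Import all_boot all_order all_algebra.
From mathcomp Require Import all_classical all_reals all_analysis.
Set Implicit Arguments. Unset Strict Implicit. Unset Printing Implicit Defensive.
Import Order.TTheory GRing.Theory Num.Theory.
Local Open Scope ring_scope.
Local Open Scope classical_set_scope.

(* A node of the infinite rooted binary tree is encoded by the path of
   left/right moves from the root: a [seq bool]; the root is [::]. *)
Definition node := seq bool.

Definition ancestors (x : node) : seq node := [seq take k x | k <- iota 0 (size x).+1].

Definition cover (S : seq node) : nat := size (undup (flatten (map ancestors S))).

(* Probability that the random process outputs node v:
   go down size v steps (prob (1-p)/2 each) along v, then stop (prob p). *)
Definition node_prob {R : realType} (p : R) (v : node) : R :=
  ((1 - p) / 2) ^+ size v * p.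

Definition iid_random_nodes {d} {T : measurableType d} {R : realType}
    (P : probability T R) (p : R) (x : nat -> T -> node) : Prop :=
  [/\ (forall i v, measurable [set w | x i w = v]),
      (forall i v, P [set w | x i w = v] = (node_prob p v)%:E)
    & (forall (I : seq nat) (v : nat -> node), uniq I ->
        P [set w | all (fun i => x i w == v i) I]
        = (\prod_(i <- I) P [set w | x i w = v i])%E)].

(* Threshold sets: X_0 = X, X_i = {x : |D(x)| >= c_i} for i >= 1.
   Note |D(x)| = size x + 1. *)
Definition in_threshold (c : nat -> int) (j : nat) (v : node) : bool :=
  (j == 0%N) || (c j <= ((size v).+1)%:Z).

Fixpoint nsel (c : nat -> int) (x : nat -> node) (t : nat) : nat :=
  match t with
  | 0 => 0
  | t'.+1 => nsel c x t' + in_threshold c (nsel c x t') (x t')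
  end.

Definition selected (c : nat -> int) (x : nat -> node) (t : nat) : bool :=
  in_threshold c (nsel c x t) (x t).

(* T_n : number of samples seen when the n-th sample is selected
   (the least t with nsel t >= n); 0 by convention if never (a null event). *)
Definition Tsel (c : nat -> int) (x : nat -> node) (n : nat) : nat :=
  match pselect (exists t, (n <= nsel c x t)%N) with
  | left h => ex_minn (P := fun t => (n <= nsel c x t)%N)
                (let: ex_intro t ht := h in ex_intro _ t ht)
  | right _ => 0
  end.

Definition Cover_sel (c : nat -> int) (x : nat -> node) (n : nat) : nat :=
  cover [seq x t | t <- iota 0 (Tsel c x n) & selected c x t].

Definition Cover_opt (c : nat -> int) (x : nat -> node) (n : nat) : nat :=
  \max_(S : {set 'I_(Tsel c x n)} | #|S| == n) cover [seq x (val i) | i in S].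

(* Main.v *)
Require Import Defs.
From HB Require Import structures.
From mathcomp Require Import all_boot all_order all_algebra.
From mathcomp Require Import all_classical all_reals all_analysis.
From mathcomp Require Import measurable_realfun.
From mathcomp Require Import ring lra zify.

(* Let r = 1 - p, let e_j be the depth forced by the j-th threshold, and
   E = e_(n/2), so that e_j - E is bounded for n/2 <= j <= n.  Choose the
   largest m with M := 2^m <= n r^(m-E) (truncated subtraction), put
   m' = max(m, E) and l = m' - m + 1.  Both covers are of order M l.

   - Cover* <= 2 M l + B, where B counts, with multiplicity over all samples
     drawn so far, the covered nodes of depth >= m'.
   - 2 Cover >= (1 + Y) l, where Y is the number of depth-m nodes lying above
     some sample of depth >= m' selected during the second half.

   At each selection in the second half a fixed depth-m node is hit with
   probability at least of order 1/n, so Y grows like M.  All the expectations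
   needed come from one nonnegative supermartingale
   (M0 + B + 2 sum_(j <= i < n) b / rho_i) * G, where rho_i = r^e_i is the
   probability of passing the i-th threshold, b bounds the mean increment of
   B, and G >= 1/(1+Y) at the end; the product form avoids having to decouple
   B from Y.  With G of order 1/M at the start this gives
   E[(M + B)/(1 + Y)] = O(1), hence the competitive ratio; G = 1 gives
   E[B] = O(M) and the finiteness of T_n; and E[Cover] >= c M l follows from
   E[M l/Cover] = O(1) through u + v^2/u >= 2v. *)

Set Implicit Arguments. Unset Strict Implicit. Unset Printing Implicit Defensive.
Import Order.TTheory GRing.Theory Num.Theory.
Local Open Scope ring_scope.
Local Open Scope classical_set_scope.

(** * Variables with countably many values *)

Section CountableFibers.
Context d (T : measurableType d) (R : realType) (P : probability T R).

(** [C] carries no sigma-algebra: measurability of [f] is expressed through its fibres. Grouping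
    outcomes by the code [pickle (f w)] writes any preimage as a countable union of fibres and empty
    sets. *)
Lemma measurable_fibers_preimage (C : countType) (f : T -> C) (A : set C) :
  (forall v, measurable [set w | f w = v]) -> measurable (f @^-1` A).
Proof.
move=> mf.
have -> : f @^-1` A = \bigcup_k [set w | pickle (f w) = k /\ A (f w)].
  by apply/seteqP; split=> [w Aw|w [k _ [_ Aw]]] //; exists (pickle (f w)).
apply: bigcup_measurable => k _.
case Ek: (@pickle_inv C k) => [v|]; last first.
  rewrite (_ : mkset _ = set0) //; apply/seteqP; split=> // w [wk _].
  by rewrite -wk pickleK_inv in Ek.
have [Av|nAv] := pselect (A v); last first.
  rewrite (_ : mkset _ = set0) //; apply/seteqP; split=> // w [wk Aw].
  by move: Ek Aw; rewrite -wk pickleK_inv => -[->].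
have [pv|pv] := eqVneq (pickle v) k.
  rewrite (_ : mkset _ = [set w | f w = v]) //; apply/seteqP; split=> w /=.
    by move=> [wk _]; move: Ek; rewrite -wk pickleK_inv => -[].
  by move=> ->.
rewrite (_ : mkset _ = set0) //; apply/seteqP; split=> // w [wk _].
by move: Ek; rewrite -wk pickleK_inv => -[fv]; rewrite -fv wk eqxx in pv.
Qed.

Lemma measurable_fun_fibers d' (U : measurableType d') (C : countType)
    (f : T -> C) (g : C -> U) (D : set T) :
  (forall v, measurable [set w | f w = v]) ->
  measurable_fun D (fun w => g (f w)).
Proof.
move=> mf; apply: (@measurable_funTS _ _ _ _ _ (g \o f)) => _ A mA.
rewrite setTI comp_preimage.
exact: measurable_fibers_preimage.
Qed.

Lemma ge0_integral_fibers (C : countType) (f : T -> C) (D : set T)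
    (F : T -> \bar R) :
  measurable D -> (forall v, measurable [set w | f w = v]) ->
  measurable_fun [set: T] F -> (forall w, 0 <= F w)%E ->
  (\int[P]_(w in D) F w =
   \sum_(k <oo) \int[P]_(w in D `&` [set w | pickle (f w) = k]) F w)%E.
Proof.
move=> mD mf mF F0.
have DE : D = \bigcup_k (D `&` [set w | pickle (f w) = k]).
  by apply/seteqP; split=> [w Dw|w [k _ []]] //; exists (pickle (f w)).
rewrite [in LHS]DE ge0_integral_bigcup //.
- move=> k; apply: measurableI => //.
  exact: (@measurable_fibers_preimage _ _ [set v | pickle v = k]).
- exact: measurable_funTS.
- apply/trivIsetP => i j _ _ ij; apply/seteqP; split=> // w /= [[_ wi] [_ wj]].
  by move: ij; rewrite -wi -wj eqxx.
Qed.

(** [g (f w)] is constant on each fibre, so independence of [A] from every single fibre suffices. *)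
Lemma ge0_integral_indep (C : countType) (f : T -> C) (A : set T)
    (g : C -> \bar R) :
  measurable A -> (forall v, measurable [set w | f w = v]) ->
  (forall v, P (A `&` [set w | f w = v]) = P A * P [set w | f w = v])%E ->
  (forall v, 0 <= g v)%E ->
  (\int[P]_(w in A) g (f w) = P A * \int[P]_w g (f w))%E.
Proof.
move=> mA mf indep g0.
have mg D : measurable_fun D (fun w => g (f w)) by exact: measurable_fun_fibers.
have PA : P A = (fine (P A))%:E by rewrite fineK // fin_num_measure.
rewrite (ge0_integral_fibers mA mf) // (ge0_integral_fibers measurableT mf) //.
rewrite PA -nneseriesZl; last by move=> *; exact: integral_ge0.
apply: eq_eseriesr => k _; rewrite -PA setTI.
have [[v vk]|nk] := pselect (exists v : C, pickle v = k); last first.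
  rewrite (_ : [set w | pickle (f w) = k] = set0) ?setI0 ?integral_set0 ?mule0 //.
  by apply/seteqP; split=> // w /= wk; apply: nk; exists (f w).
have -> : [set w | pickle (f w) = k] = [set w | f w = v].
  apply/seteqP; split=> w /=; last by move=> ->.
  by rewrite -vk => /(pcan_inj (@pickleK_inv C)) .
rewrite (@eq_integral _ _ _ _ (A `&` _) (cst (g v))); last first.
  by move=> w; rewrite inE => -[_ /= ->].
rewrite [in RHS](@eq_integral _ _ _ _ _ (cst (g v))); last first.
  by move=> w; rewrite inE /= => ->.
rewrite !integral_cst //; last exact: measurableI.
rewrite -[X in _ = (_ * (_ * X))%E]/(P [set w | f w = v]).
by rewrite [LHS](congr1 (mule (g v)) (indep v)) muleCA.
Qed.

(** Takes the place of conditioning: with the past frozen at [f w = u], independence lets the new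
    variable [g] be integrated alone. This drives each supermartingale step. *)
Lemma le_integral_indep_step (C D : countType) (f : T -> C) (g : T -> D)
    (Psi : C -> D -> \bar R) (phi : C -> \bar R) :
  (forall v, measurable [set w | f w = v]) ->
  (forall v, measurable [set w | g w = v]) ->
  (forall u v, P ([set w | f w = u] `&` [set w | g w = v]) =
     P [set w | f w = u] * P [set w | g w = v])%E ->
  (forall u v, 0 <= Psi u v)%E ->
  (forall u, \int[P]_w Psi u (g w) <= phi u)%E ->
  (\int[P]_w Psi (f w) (g w) <= \int[P]_w phi (f w))%E.
Proof.
move=> mf mg indep Psi0 le_phi.
have phi0 u : (0 <= phi u)%E.
  by apply: le_trans (le_phi u); apply: integral_ge0.
have mfg (w' : C * D) : measurable [set w | (f w, g w) = w'].
  rewrite (_ : mkset _ = [set w | f w = w'.1] `&` [set w | g w = w'.2]).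
    exact: measurableI.
  apply/seteqP; split=> w /=; first by move=> <-.
  by case: w' => a b /= [-> ->].
have mPsi : measurable_fun setT (fun w => Psi (f w) (g w)).
  exact: (measurable_fun_fibers (fun z => Psi z.1 z.2) mfg).
have mphi : measurable_fun setT (fun w => phi (f w)) by exact: measurable_fun_fibers.
rewrite (ge0_integral_fibers measurableT mf) // (ge0_integral_fibers measurableT mf) //.
apply: lee_nneseries => [k _|k _]; first by move=> *; exact: integral_ge0.
rewrite setTI.
have [[v vk]|nk] := pselect (exists v : C, pickle v = k); last first.
  rewrite (_ : [set w | pickle (f w) = k] = set0) ?integral_set0 //.
  by apply/seteqP; split=> // w /= wk; apply: nk; exists (f w).
have -> : [set w | pickle (f w) = k] = [set w | f w = v].
  apply/seteqP; split=> w /=; last by move=> ->.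
  by rewrite -vk => /(pcan_inj (@pickleK_inv C)).
rewrite (@eq_integral _ _ _ _ _ (fun w => Psi v (g w))); last first.
  by move=> w; rewrite inE => /= ->.
rewrite [leRHS](@eq_integral _ _ _ _ _ (cst (phi v))); last first.
  by move=> w; rewrite inE /= => ->.
rewrite integral_cst // ge0_integral_indep //.
by rewrite muleC lee_wpmul2r.
Qed.

End CountableFibers.

(** * The law of a random node *)

Definition level (k : nat) : seq node := [seq val t | t <- enum {: k.-tuple bool}].

Lemma mem_level k v : (v \in level k) = (size v == k).
Proof.
apply/mapP/eqP => [[t _ ->]|kv]; first exact: size_tuple.
by exists (@Tuple k bool v (introT eqP kv)); rewrite ?mem_enum.
Qed.

Lemma level_uniq k : uniq (level k).
Proof. by rewrite map_inj_uniq ?enum_uniq //; exact: val_inj. Qed.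

Lemma size_level k : size (level k) = (2 ^ k)%N.
Proof. by rewrite size_map -cardE card_tuple card_bool. Qed.

(** Cutting [v] into [take m v] and [drop m v] injects the counted nodes into [A] times
    [level (k - m)]. *)
Lemma count_take_level (A : seq node) m k : (m <= k)%N ->
  (count (fun v => take m v \in A) (level k) <= size A * 2 ^ (k - m))%N.
Proof.
move=> mk; rewrite -size_filter -size_level -(size_allpairs cat).
apply: uniq_leq_size; first by rewrite filter_uniq // level_uniq.
move=> v; rewrite mem_filter mem_level => /andP[vA /eqP vk].
apply/allpairsP; exists (take m v, drop m v) => /=; split=> //.
  by rewrite mem_level size_drop vk.
by rewrite cat_take_drop.
Qed.

Section NodeLaw.
Context d (T : measurableType d) (R : realType) (P : probability T R).
Context (p : R) (X : T -> node).
Hypotheses (p0 : 0 < p) (p1 : p < 1).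
Hypothesis mX : forall v, measurable [set w | X w = v].
Hypothesis lawX : forall v, P [set w | X w = v] = (node_prob p v)%:E.

Let mQ (Q : node -> Prop) : measurable [set w | Q (X w)].
Proof. exact: (measurable_fibers_preimage [set v | Q v] mX). Qed.

Let r0 : 0 <= 1 - p. Proof. by rewrite subr_ge0 ltW. Qed.
Let r1 : 1 - p <= 1. Proof. by rewrite lerBlDr lerDl ltW. Qed.

Lemma prob_mem_seq (s : seq node) : uniq s ->
  P [set w | X w \in s] = (\sum_(v <- s) node_prob p v)%:E.
Proof.
elim: s => [_|v s IH /= /andP[vs us]].
  rewrite big_nil (_ : mkset _ = set0) ?measure0 //.
  by apply/seteqP; split.
rewrite big_cons EFinD -lawX -IH // -measureU //; last first.
- by apply/seteqP; split=> // w /= [->]; apply/negP.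
- exact: (mQ (fun u => u \in s)).
congr (P _); apply/seteqP; split=> w /=; rewrite inE.
  by move=> /orP[/eqP|]; [left|right].
by move=> [->|->]; rewrite ?eqxx ?orbT.
Qed.

Lemma prob_level (Q : pred node) k :
  P [set w | size (X w) = k /\ Q (X w)] =
  ((count Q (level k))%:R * ((1 - p) / 2) ^+ k * p)%:E.
Proof.
rewrite (_ : mkset _ = [set w | X w \in [seq v <- level k | Q v]]); last first.
  apply/seteqP; split=> w /=; rewrite mem_filter mem_level.
    by move=> [/eqP -> ->].
  by move=> /andP[-> /eqP].
rewrite prob_mem_seq ?filter_uniq ?level_uniq //; congr EFin.
rewrite (eq_big_seq (fun=> ((1 - p) / 2) ^+ k * p)); last first.
  by move=> v; rewrite mem_filter mem_level /node_prob => /andP[_ /eqP ->].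
by rewrite big_filter big_const_seq iter_addr_0 -[LHS]mulr_natl mulrA.
Qed.

Lemma prob_size_split (Q : pred node) k :
  (P [set w | (k <= size (X w))%N /\ Q (X w)] =
   P [set w | size (X w) = k /\ Q (X w)] +
   P [set w | (k.+1 <= size (X w))%N /\ Q (X w)])%E.
Proof.
rewrite -measureU.
- congr (P _); apply/seteqP; split=> w /=; last first.
    by move=> [[-> ?]|[/ltnW]].
  by rewrite leq_eqVlt => -[/orP[/eqP <-|?] ?]; [left|right].
- exact: (mQ (fun v => size v = k /\ Q v)).
- exact: (mQ (fun v => (k.+1 <= size v)%N /\ Q v)).
- by apply/seteqP; split=> // w /= [[-> _] []]; rewrite ltnn.
Qed.

Lemma prob_size_ge k : P [set w | (k <= size (X w))%N] = ((1 - p) ^+ k)%:E.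
Proof.
have E n : [set w | (n <= size (X w))%N] = [set w | (n <= size (X w))%N /\ predT (X w)].
  by apply/seteqP; split=> w //= [].
elim: k => [|k IH].
  by rewrite expr0 -(@probability_setT _ _ _ P); congr (P _); apply/seteqP; split.
have := prob_size_split predT k; rewrite -!E IH prob_level count_predT size_level.
have -> : (2 ^ k)%:R * ((1 - p) / 2) ^+ k * p = (1 - p) ^+ k * p :> R.
  by rewrite natrX -exprMn; congr (_ ^+ _ * _); field.
have : P [set w | (k < size (X w))%N] \is a fin_num.
  by rewrite fin_num_measure //; exact: (mQ (fun v => (k < size v)%N)).
move/fineK <- => -[] /eqP; rewrite addrC -subr_eq => /eqP <-.
by congr EFin; rewrite exprSr; ring.
Qed.

(** The law is uniform on each level, and on every level from [k] on at most a fraction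
    [size A / 2 ^ m] of the nodes has its depth-[m] prefix in [A]. *)
Lemma prob_prefix_notin_ge (A : seq node) m k : (m <= k)%N ->
  (((1 - (size A)%:R / 2 ^+ m) * (1 - p) ^+ k)%:E <=
   P [set w | (k <= size (X w))%N /\ take m (X w) \notin A])%E.
Proof.
move=> mk; pose Q := [pred v : node | take m v \notin A].
pose a n := P [set w | (n <= size (X w))%N /\ Q (X w)].
rewrite -[leRHS]/(a k); set c := 1 - _.
have step n : (m <= n)%N -> ((c * (1 - p) ^+ n * p)%:E + a n.+1 <= a n)%E.
  move=> mn; rewrite [leRHS]prob_size_split leeD2r // prob_level lee_fin.
  rewrite ler_pM2r //.
  have := count_take_level A mn; have := count_predC (mem A \o take m) (level n).
  rewrite size_level => /(congr1 (fun z => z%:R : R)).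
  rewrite -(@ler_nat R) natrD natrM !natrX -[Q]/(predC (mem A \o take m)).
  set u := (count (mem A \o take m) _)%:R; set v := (count _ _)%:R => uv.
  move=> uA.
  have -> : c * (1 - p) ^+ n = (2 ^+ n - (size A)%:R * 2 ^+ (n - m)) * ((1 - p) / 2) ^+ n.
    have E2 : 2 ^+ n = 2 ^+ (n - m) * 2 ^+ m :> R by rewrite -exprD subnK.
    have : 2 ^+ m != 0 :> R by rewrite expf_neq0.
    have : 2 ^+ (n - m) != 0 :> R by rewrite expf_neq0.
    rewrite exprMn exprVn /c E2; move: (2 ^+ _) (2 ^+ m) => a1 b1 a10 b10.
    by field; rewrite a10 b10.
  rewrite ler_wpM2r //; first by rewrite exprn_ge0 // divr_ge0.
  by rewrite -uv lerBlDr addrC lerD2l.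
(* Telescoping over finitely many lengths; then L tends to infinity. *)
have iter L : ((c * ((1 - p) ^+ k - (1 - p) ^+ (k + L)))%:E <= a k)%E.
  suff: ((c * ((1 - p) ^+ k - (1 - p) ^+ (k + L)))%:E + a (k + L)%N <= a k)%E.
    by apply: le_trans; rewrite leeDl // measure_ge0.
  elim: L => [|L IH]; first by rewrite addn0 subrr mulr0 add0e.
  apply: le_trans IH; rewrite addnS.
  rewrite [X in ((c * X)%:E + _)%E](_ : _ = (1 - p) ^+ k - (1 - p) ^+ (k + L) + (1 - p) ^+ (k + L) * p); last first.
    by rewrite exprS; ring.
  rewrite mulrDr mulrA EFinD -addeA leeD2l // step //.
  exact: leq_trans mk (leq_addr _ _).
have fa : a k = (fine (a k))%:E.
  by rewrite fineK // fin_num_measure //; exact: (mQ (fun v => (k <= size v)%N /\ Q v)).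
rewrite fa lee_fin.
have cv : c * ((1 - p) ^+ k - (1 - p) ^+ k * (1 - p) ^+ L) @[L --> \oo] -->
    c * ((1 - p) ^+ k - (1 - p) ^+ k * 0).
  apply: cvgMr; apply: cvgB; first exact: cvg_cst.
  apply: cvgMr; apply: cvg_expr.
  by rewrite ger0_norm // ltrBlDr ltrDl.
rewrite mulr0 subr0 in cv.
rewrite -(cvg_lim _ cv) //; apply: limr_le; first exact: cvgP cv.
by apply: nearW => L; have := iter L; rewrite fa lee_fin exprD.
Qed.

(** Tail-sum formula: the excess is the number of [i] with [k + i <= size v], and these tails form a
    geometric series. *)
Lemma integral_depth_excess k :
  (\int[P]_w (((size (X w)).+1 - k)%:R : R)%:E <= ((1 - p) ^+ k / p)%:E)%E.
Proof.
have E (v : node) : (((size v).+1 - k)%:R : R)%:E =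
    (\sum_(i <oo) (((k + i <= size v)%N)%:R : R)%:E)%E.
  rewrite (nneseries_split 0 ((size v).+1 - k)) //= add0n.
  rewrite [X in (_ + X)%E]eseries0 ?adde0; last first.
    by move=> i; rewrite leq_subLR ltnNge => /negbTE ->.
  rewrite sumEFin; congr EFin.
  rewrite big_nat (eq_bigr (fun=> 1)) => [|i /andP[_ ik]].
    by rewrite -big_nat big_const_nat iter_addr_0 subn0.
  by rewrite -ltnS -ltn_subRL ik.
under eq_integral do rewrite E.
have mf i : measurable_fun [set: T] (fun w => (((k + i <= size (X w))%N)%:R : R)%:E).
  exact: (measurable_fun_fibers (fun v : node => (((k + i <= size v)%N)%:R : R)%:E) mX).
rewrite integral_nneseries //.
have I i : (\int[P]_w (((k + i <= size (X w))%N)%:R : R)%:E = ((1 - p) ^+ (k + i))%:E)%E.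
  rewrite -prob_size_ge -[X in P X]setIT -integral_indic //; last first.
    exact: (mQ (fun v => (k + i <= size v)%N)).
  by apply: eq_integral => w _; rewrite indicE /= mem_setE.
apply: lime_le; first by apply: is_cvg_nneseries => i _ _; exact: integral_ge0.
apply: nearW => L.
rewrite (eq_bigr (fun i => ((1 - p) ^+ (k + i))%:E)) // sumEFin lee_fin.
suff -> : \sum_(0 <= i < L) (1 - p) ^+ (k + i) = ((1 - p) ^+ k - (1 - p) ^+ (k + L)) / p.
  have pV0 : 0 <= p^-1 by rewrite invr_ge0 ltW.
  by rewrite ler_wpM2r // lerBlDr lerDl exprn_ge0.
elim: L => [|L IH]; first by rewrite big_geq // addn0 subrr mul0r.
rewrite big_nat_recr //= IH addnS exprS; field.
by rewrite gt_eqF.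
Qed.

End NodeLaw.

(** * Histories and the supermartingale *)

(** The least depth that passes threshold [j]. A path has one node more than its depth, hence
    [c j - 1]; negative values are truncated to 0, and index 0 accepts every node whatever [c 0]
    is. *)
Definition depth_thr (c : nat -> int) (j : nat) : nat :=
  if j == 0%N then 0%N else absz (Num.max 0 (c j - 1)).

Lemma in_thresholdE c j v : in_threshold c j v = (depth_thr c j <= size v)%N.
Proof.
rewrite /in_threshold /depth_thr; case: eqP => //= _.
by case: (leP 0 (c j - 1)) => ?; lia.
Qed.

Lemma nsel_ext c (x y : nat -> node) t :
  (forall i, (i < t)%N -> x i = y i) -> nsel c x t = nsel c y t.
Proof.
elim: t => //= t IH xy; rewrite IH => [|i it]; last by apply: xy; exact: ltnW.
by rewrite xy.
Qed.

Lemma nsel_mono c x s t : (s <= t)%N -> (nsel c x s <= nsel c x t)%N.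
Proof.
elim: t => [|t IH]; first by rewrite leqn0 => /eqP ->.
rewrite leq_eqVlt => /orP[/eqP -> //|st]; apply: leq_trans (IH st) _ => /=.
exact: leq_addr.
Qed.

Definition nselh c (h : seq node) := nsel c (nth [::] h) (size h).

Lemma nselh_mkseq c x t : nselh c (mkseq x t) = nsel c x t.
Proof. by rewrite /nselh size_mkseq; apply: nsel_ext => i it; rewrite nth_mkseq. Qed.

Lemma nsel_rcons c h v t : (t <= size h)%N ->
  nsel c (nth [::] (rcons h v)) t = nsel c (nth [::] h) t.
Proof.
by move=> th; apply: nsel_ext => i it; rewrite nth_rcons (leq_trans it th).
Qed.

Lemma nselh_rcons c h v :
  nselh c (rcons h v) = (nselh c h + in_threshold c (nselh c h) v)%N.
Proof.
by rewrite /nselh size_rcons /= nsel_rcons // nth_rcons ltnn eqxx.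
Qed.

(** The history frozen at the [n]-th selection. As a fold it grows by one sample at a time, and it
    makes sense on outcomes where that selection never happens. *)
Definition stopped c n (s : seq node) : seq node :=
  foldl (fun h v => if (n <= nselh c h)%N then h else rcons h v) [::] s.

Lemma stopped_rcons c n s v : stopped c n (rcons s v) =
  if (n <= nselh c (stopped c n s))%N then stopped c n s
  else rcons (stopped c n s) v.
Proof. by rewrite /stopped foldl_rcons. Qed.

Lemma stopped_mkseq c n x t :
  (forall s, (s < t)%N -> (nsel c x s < n)%N) ->
  stopped c n (mkseq x t) = mkseq x t.
Proof.
elim: t => // t IH lt_n; rewrite mkseqS stopped_rcons IH; last first.
  by move=> s st; apply: lt_n; exact: ltnW.
by rewrite nselh_mkseq leqNgt lt_n.
Qed.

Lemma stopped_mkseq_ge c n x tau t :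
  (forall s, (s < tau)%N -> (nsel c x s < n)%N) -> (n <= nsel c x tau)%N ->
  (tau <= t)%N -> stopped c n (mkseq x t) = mkseq x tau.
Proof.
move=> lt_n ge_n; elim: t => [|t IH].
  by rewrite leqn0 => /eqP t0; rewrite t0 in lt_n *; exact: stopped_mkseq.
rewrite leq_eqVlt => /orP[/eqP <-|]; first exact: stopped_mkseq.
rewrite ltnS => taut; rewrite mkseqS stopped_rcons IH //.
by rewrite nselh_mkseq ge_n.
Qed.

Lemma integral_prob_cst d (T : measurableType d) (R : realType)
    (P : probability T R) (k : \bar R) : (\int[P]_w k = k)%E.
Proof.
have := integral_cst P measurableT k; rewrite /cst => ->.
by rewrite -[X in (_ * X)%E]/(P setT) probability_setT mule1.
Qed.

Section History.
Context d (T : measurableType d) (R : realType) (P : probability T R).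
Context (p : R) (x : nat -> T -> node).
Hypothesis iid : iid_random_nodes P p x.

Lemma measurable_hist t h : measurable [set w | mkseq (x^~ w) t = h].
Proof.
have [mx _ _] := iid.
elim: t h => [|t IH] h.
  case: h => [|v h]; first by rewrite (_ : mkset _ = setT) //; apply/seteqP; split.
  by rewrite (_ : mkset _ = set0) //; apply/seteqP; split.
case/lastP: h => [|h v].
  have -> : [set w | mkseq (x^~ w) t.+1 = [::]] = set0 by apply/seteqP; split.
  exact: measurable0.
have -> : [set w | mkseq (x^~ w) t.+1 = rcons h v] =
    [set w | mkseq (x^~ w) t = h] `&` [set w | x t w = v].
  apply/seteqP; split=> w; rewrite /mkset mkseqS.
    by move=> /rcons_inj [wh wv]; split.
  by move=> [/= -> ->].
exact: measurableI.
Qed.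

Lemma hist_indep t h v :
  (P ([set w | mkseq (x^~ w) t = h] `&` [set w | x t w = v]) =
   P [set w | mkseq (x^~ w) t = h] * P [set w | x t w = v])%E.
Proof.
have [mx _ indep] := iid.
have [sh|sh] := eqVneq (size h) t; last first.
  rewrite (_ : [set w | mkseq (x^~ w) t = h] = set0) ?set0I ?measure0 ?mul0e //.
  apply/seteqP; split=> // w /= wh; move: sh.
  by rewrite -wh size_mkseq eqxx.
have histE k : (k <= t)%N -> [set w | mkseq (x^~ w) k = take k h] =
    [set w | all (fun i => x i w == nth [::] (rcons h v) i) (iota 0 k)].
  move=> kt; apply/seteqP; split=> w /=.
    move=> wh; apply/allP => i; rewrite mem_iota add0n => ik; apply/eqP.
    rewrite nth_rcons sh (leq_trans ik kt) -(nth_take _ ik) -wh.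
    by rewrite nth_mkseq.
  move=> /allP wh; apply: (@eq_from_nth _ [::]).
    by rewrite size_mkseq size_take sh; case: ltngtP kt.
  rewrite size_mkseq => i ik; rewrite nth_mkseq // nth_take //.
  have := wh i; rewrite mem_iota add0n => /(_ ik) /eqP ->.
  by rewrite nth_rcons sh (leq_trans ik kt).
have := histE t (leqnn t); rewrite take_oversize ?sh // => ->.
have := indep (iota 0 t.+1) (nth [::] (rcons h v)) (iota_uniq _ _).
rewrite -addn1 iotaD big_cat /= big_seq1 add0n.
rewrite -indep ?iota_uniq // nth_rcons sh ltnn eqxx => <-.
congr (P _); apply/seteqP; split=> w /=; rewrite all_cat /= nth_rcons sh ltnn eqxx andbT.
  by move=> [-> /eqP].
by move=> /andP[-> /eqP].
Qed.

(** Optional stopping at a bounded time: a complete history no longer moves, and an incomplete one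
    is extended by a sample independent of it. *)
Lemma integral_stopped_le c n (pot : seq node -> R) :
  (forall h, 0 <= pot h) ->
  (forall t h, (nselh c h < n)%N ->
    (\int[P]_w (pot (rcons h (x t w)))%:E <= (pot h)%:E)%E) ->
  forall t, (\int[P]_w (pot (stopped c n (mkseq (x^~ w) t)))%:E <= (pot [::])%:E)%E.
Proof.
move=> pot0 step; have [mx _ _] := iid; elim=> [|t IH].
  by rewrite [leLHS](integral_prob_cst P (pot [::])%:E).
apply: le_trans IH.
under eq_integral do rewrite mkseqS stopped_rcons.
apply: (@le_integral_indep_step _ _ _ P _ _ (fun w => mkseq (x^~ w) t) (x t)
  (fun s v => (pot (if (n <= nselh c (stopped c n s))%N then stopped c n s
                    else rcons (stopped c n s) v))%:E)
  (fun s => (pot (stopped c n s))%:E)) => //.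
- exact: measurable_hist.
- exact: hist_indep.
- by move=> *; rewrite lee_fin.
- move=> s /=; case: leqP => sn; last exact: step.
  by rewrite integral_prob_cst.
Qed.

End History.

(** In the cross term [i * g'] the new weight depends on the same sample as the increment [i]. Here
    and in the next lemma it is bounded by [2 * g * i], whose weight is known from the past. *)
Lemma potential_unselected (R : realDomainType) (X i g g' : R) :
  0 <= X -> 0 <= i -> 0 <= g -> g' <= g ->
  (X + i) * g' <= X * g + 2 * g * i.
Proof. by move=> *; nra. Qed.

Lemma potential_selected (R : realDomainType) (X i g g' : R) :
  0 <= i -> g' <= 2 * g -> (X + i) * g' <= X * g' + 2 * g * i.
Proof. by move=> *; nra. Qed.

Section Potential.
Context d (T : measurableType d) (R : realType) (P : probability T R).
Context (p : R) (x : nat -> T -> node) (c : nat -> int) (n : nat).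
Hypotheses (p0 : 0 < p) (p1 : p < 1).
Hypothesis iid : iid_random_nodes P p x.
Context (M0 b : R) (inc : node -> R) (G : seq node -> R).
Hypotheses (M00 : 0 <= M0) (b0 : 0 <= b) (inc0 : forall v, 0 <= inc v).
Hypothesis G0 : forall h, 0 <= G h.
Hypothesis inc_le : forall t, (\int[P]_w (inc (x t w))%:E <= b%:E)%E.
Hypothesis G_unsel : forall h v, (nselh c h < n)%N ->
  ~~ in_threshold c (nselh c h) v -> G (rcons h v) <= G h.
Hypothesis G_sel : forall h v, (nselh c h < n)%N ->
  in_threshold c (nselh c h) v -> G (rcons h v) <= 2 * G h.
(** As the power of [1 - p] is the probability of selection, this says that the mean of [G], given
    that the next sample is selected, does not grow. *)
Hypothesis G_step : forall h t, (nselh c h < n)%N ->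
  (\int[P]_w ((in_threshold c (nselh c h) (x t w))%:R * G (rcons h (x t w)))%:E
   <= ((1 - p) ^+ depth_thr c (nselh c h) * G h)%:E)%E.

(* The factor 2 absorbs the dependence between the increment of a selected
   sample and the weight G, which at most doubles at a selection. *)
Definition reserve (j : nat) : R :=
  2 * \sum_(j <= i < n) b / (1 - p) ^+ depth_thr c i.

Definition potential (h : seq node) : R :=
  (M0 + \sum_(v <- h) inc v + reserve (nselh c h)) * G h.

Let rho0 j : 0 < (1 - p) ^+ depth_thr c j.
Proof. by rewrite exprn_gt0 // subr_gt0. Qed.

Lemma reserve_ge0 j : 0 <= reserve j.
Proof.
rewrite mulr_ge0 // sumr_ge0 // => i _.
by rewrite divr_ge0 // ltW.
Qed.

Let base_ge0 h j : 0 <= M0 + \sum_(v <- h) inc v + reserve j.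
Proof. by rewrite !addr_ge0 ?reserve_ge0 // sumr_ge0. Qed.

Lemma potential_ge0 h : 0 <= potential h.
Proof. by rewrite mulr_ge0. Qed.

(** A selection has probability [rho] and lowers the reserve by [2 * b / rho]; on average this pays
    exactly for the term [2 * G h * b] caused by the increment. *)
Lemma potential_step t h : (nselh c h < n)%N ->
  (\int[P]_w (potential (rcons h (x t w)))%:E <= (potential h)%:E)%E.
Proof.
move=> hn; have [mx lawx _] := iid; set j := nselh c h in hn *.
set sel := in_threshold c j; set rho := (1 - p) ^+ depth_thr c j.
pose S := M0 + \sum_(v <- h) inc v.
have S0 i : 0 <= S + reserve i by exact: base_ge0.
(* Three terms that integrate separately: no selection (mass [1 - rho]), selection (controlled by
   [G_step]), and the increment (mean at most [b]). *)
have pt v : potential (rcons h v) <=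
    (S + reserve j) * G h * (~~ sel v)%:R
    + ((S + reserve j.+1) * ((sel v)%:R * G (rcons h v)) + 2 * G h * inc v).
  rewrite /potential nselh_rcons big_rcons /= -/j -/sel addrA -/S.
  case: (boolP (sel v)) => sv /=.
    rewrite addn1 mulr0 add0r mul1r -addrA (addrC (inc v)) addrA.
    exact: (potential_selected _ (inc0 v) (G_sel hn sv)).
  rewrite addn0 mul0r mulr0 add0r mulr1 -addrA (addrC (inc v)) addrA.
  exact: (potential_unselected (base_ge0 _ _) (inc0 v) (G0 h) (G_unsel hn sv)).
have mF (f : node -> \bar R) : measurable_fun [set: T] (fun w => f (x t w)).
  exact: (measurable_fun_fibers f (mx t)).
have psel : (\int[P]_w ((~~ sel (x t w))%:R : R)%:E = (1 - rho)%:E)%E.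
  have mA : measurable [set w | (depth_thr c j <= size (x t w))%N].
    exact: (measurable_fibers_preimage [set v : node | (depth_thr c j <= size v)%N] (mx t)).
  rewrite /rho EFinB -(prob_size_ge (mx t) (lawx t)) -probability_setC //.
  rewrite -[X in _ = P X]setIT -integral_indic //; last exact: measurableC.
  apply: eq_integral => w _; rewrite indicE /sel in_thresholdE.
  by rewrite in_setC mem_setE.
pose A v : \bar R := (((S + reserve j) * G h)%:E * ((~~ sel v)%:R)%:E)%E.
pose B v : \bar R := ((S + reserve j.+1)%:E * ((sel v)%:R * G (rcons h v))%:E)%E.
pose C v : \bar R := ((2 * G h)%:E * (inc v)%:E)%E.
have A0 v : (0 <= A v)%E by rewrite /A /B /C -EFinM lee_fin !mulr_ge0.
have B0 v : (0 <= B v)%E by rewrite /A /B /C -EFinM lee_fin !mulr_ge0.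
have C0 v : (0 <= C v)%E by rewrite /A /B /C -EFinM lee_fin !mulr_ge0.
apply: (@le_trans _ _ (\int[P]_w (A (x t w) + (B (x t w) + C (x t w)))%E)%E).
  apply: ge0_le_integral => //.
  - by move=> w _; rewrite lee_fin potential_ge0.
  - exact: (mF (fun v => (potential (rcons h v))%:E)).
  - exact: (mF (fun v => A v + (B v + C v))%E).
  - by move=> w _; rewrite /A /B /C -!EFinM -!EFinD lee_fin pt.
rewrite ge0_integralD //; [|by move=> w _; rewrite adde_ge0|exact: (mF (fun v => B v + C v)%E)].
rewrite ge0_integralD //.
have mA' : measurable_fun [set: T] (fun w => ((~~ sel (x t w))%:R : R)%:E).
  exact: (mF (fun v => ((~~ sel v)%:R)%:E)).
have mB' : measurable_fun [set: T]
    (fun w => ((sel (x t w))%:R * G (rcons h (x t w)))%:E).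
  exact: (mF (fun v => ((sel v)%:R * G (rcons h v))%:E)).
have mC' : measurable_fun [set: T] (fun w => (inc (x t w))%:E).
  exact: (mF (fun v => (inc v)%:E)).
rewrite (ge0_integralZl_EFin _ _ _ mA') //; last by rewrite mulr_ge0.
rewrite (ge0_integralZl_EFin _ _ _ mB') //; last first.
  by move=> w _; rewrite lee_fin mulr_ge0.
rewrite (ge0_integralZl_EFin _ _ _ mC') //; [|by move=> w _; rewrite lee_fin|by rewrite mulr_ge0].
rewrite psel.
apply: (@le_trans _ _ (((S + reserve j) * G h)%:E * (1 - rho)%:E +
   ((S + reserve j.+1)%:E * (rho * G h)%:E + (2 * G h)%:E * b%:E))%E).
  rewrite leeD2l // leeD // lee_wpmul2l ?lee_fin //; first exact: G_step.
  by rewrite mulr_ge0.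
rewrite -!EFinM -!EFinD lee_fin /potential -/j -/S.
have -> : reserve j = 2 * (b / rho) + reserve j.+1.
  by rewrite /reserve big_ltn // mulrDr.
rewrite le_eqVlt; apply/orP; left; apply/eqP; field.
by rewrite gt_eqF // /rho.
Qed.

Lemma integral_potential_le t :
  (\int[P]_w (potential (stopped c n (mkseq (x^~ w) t)))%:E
   <= (potential [::])%:E)%E.
Proof.
apply: (integral_stopped_le iid) => [h|t' h]; first exact: potential_ge0.
exact: potential_step.
Qed.

End Potential.

(** * Covers and hits *)

Lemma mem_ancestors u v : (u \in ancestors v) = (u == take (size u) v).
Proof.
apply/mapP/eqP => [[k _ ->]|uv].
  by rewrite size_take; case: ltnP => // kv; rewrite take_size take_oversize.
exists (size u) => //; rewrite mem_iota add0n ltnS [X in size X]uv size_take.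
by case: (ltnP (size u) (size v)) => [uv'|_]; rewrite ?leqnn ?(ltnW uv').
Qed.

Lemma uniq_ancestors v : uniq (ancestors v).
Proof.
rewrite map_inj_in_uniq ?iota_uniq // => i j.
rewrite !mem_iota !add0n !ltnS => /andP[_ iv] /andP[_ jv] /(congr1 size).
by rewrite !size_takel.
Qed.

Lemma count_ancestors m v :
  count (fun u => m <= size u)%N (ancestors v) = ((size v).+1 - m)%N.
Proof.
rewrite count_map (eq_in_count (a2 := fun k => (m <= k)%N)); last first.
  move=> k; rewrite mem_iota add0n ltnS => /andP[_ kv].
  by rewrite /= size_takel.
elim: (size v).+1 => [|k IH]; first by rewrite sub0n.
rewrite -addn1 iotaD count_cat IH /= add0n; case: leqP => ?; lia.
Qed.

Lemma Cover_subset s1 s2 : {subset s1 <= s2} -> (Defs.cover s1 <= Defs.cover s2)%N.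
Proof.
move=> s12; apply: uniq_leq_size; first exact: undup_uniq.
move=> u; rewrite !mem_undup => /flattenP[_ /mapP[v vs ->] uv].
by apply/flattenP; exists (ancestors v) => //; rewrite map_f // s12.
Qed.

Lemma Cover_ge_size s v : v \in s -> (size v < Defs.cover s)%N.
Proof.
move=> vs; have -> : (size v).+1 = size (ancestors v) by rewrite size_map size_iota.
apply: uniq_leq_size; first exact: uniq_ancestors.
move=> u uv; rewrite mem_undup; apply/flattenP.
by exists (ancestors v) => //; rewrite map_f.
Qed.

(** There are fewer than [2 ^ m] nodes of depth below [m]; the deeper covered nodes are counted once
    per sample below them. *)
Lemma Cover_le m s :
  (Defs.cover s <= 2 ^ m + \sum_(v <- s) ((size v).+1 - m))%N.
Proof.
set F := flatten (map ancestors s).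
rewrite /Defs.cover -/F -(count_predC (fun u => m <= size u)%N) addnC leq_add //.
  rewrite -size_filter.
  have : (size (flatten [seq level k | k <- iota 0 m]) <= 2 ^ m)%N.
    rewrite size_flatten /shape -map_comp sumnE big_map.
    elim: m => [|m IH]; first by rewrite big_nil.
    rewrite -addn1 iotaD big_cat /= big_seq1 add0n size_level expnD.
    by rewrite muln2 -addnn leq_add2r.
  apply: leq_trans; apply: uniq_leq_size; first by rewrite filter_uniq ?undup_uniq.
  move=> u; rewrite mem_filter /= -ltnNge => /andP[um _].
  apply/flattenP; exists (level (size u)); last by rewrite mem_level.
  by apply: map_f; rewrite mem_iota.
apply: (@leq_trans (count (fun u => m <= size u)%N F)).
  by rewrite -!size_filter filter_undup size_undup.
rewrite count_flatten -map_comp sumnE big_map leq_sum // => v _.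
by rewrite -(count_ancestors m v).
Qed.

(** Each distinct prefix [u] gets one representative [rep u] of depth at least [m']. Its ancestors
    of depths [m] to [m'] are covered, and such an ancestor determines both its depth and [u], so
    none is counted twice. *)
Lemma Cover_ge m m' s : (m <= m')%N ->
  (size (undup [seq take m v | v <- s & (m' <= size v)%N]) * (m' - m).+1
   <= Defs.cover s)%N.
Proof.
move=> mm'; set s' := [seq v <- s | _]; set U := map _ s'.
pose rep u := nth [::] s' (index u U).
have repP u : u \in U -> [/\ rep u \in s, (m' <= size (rep u))%N & take m (rep u) = u].
  move=> uU; have iU : (index u U < size s')%N by rewrite -(size_map (take m)) index_mem.
  have : rep u \in s' by rewrite mem_nth.
  rewrite mem_filter => /andP[-> ->]; split=> //.
  by rewrite -[RHS](nth_index [::] uU) (nth_map [::]).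
rewrite -(size_iota m (m' - m).+1) -(size_allpairs (fun u k => take k (rep u))).
apply: uniq_leq_size.
  apply: allpairs_uniq; [exact: undup_uniq|exact: iota_uniq|].
  move=> [u1 k1] [u2 k2] /allpairsP[[a1 b1] [aU1 bk1 [-> ->]]].
  move=> /allpairsP[[a2 b2] [aU2 bk2 [-> ->]]].
  move: aU1 aU2 bk1 bk2; rewrite !mem_undup !mem_iota /=.
  move=> /repP[_ s1 t1] /repP[_ s2 t2] /andP[mb1 bm1] /andP[mb2 bm2] E.
  have b1s : (b1 <= size (rep a1))%N by apply: leq_trans s1; lia.
  have b2s : (b2 <= size (rep a2))%N by apply: leq_trans s2; lia.
  have b12 : b1 = b2.
    by have := congr1 size E; rewrite !size_takel.
  have := congr1 (take m) E; rewrite !take_takel //.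
  by rewrite t1 t2 b12 => ->.
move=> w /allpairsP[[u k] []]; rewrite mem_undup /= => /repP[us _ _] _ ->.
rewrite mem_undup; apply/flattenP; exists (ancestors (rep u)); first exact: map_f.
rewrite mem_ancestors size_take; case: ltnP => // kr.
by rewrite take_size take_oversize.
Qed.

(** Here [j0] bounds the number selected before: 0 gives all selected samples, [n./2] those of the
    second half. *)
Definition selfrom c (j0 : nat) (h : seq node) : seq node :=
  [seq nth [::] h t | t <- iota 0 (size h) &
    selected c (nth [::] h) t && (j0 <= nsel c (nth [::] h) t)%N].

Lemma selfrom_rcons c j0 h v : selfrom c j0 (rcons h v) =
  if in_threshold c (nselh c h) v && (j0 <= nselh c h)%N
  then rcons (selfrom c j0 h) v else selfrom c j0 h.
Proof.
rewrite {1}/selfrom size_rcons -addn1 iotaD filter_cat map_cat /= add0n.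
have -> : [seq nth [::] (rcons h v) t | t <- iota 0 (size h) &
    selected c (nth [::] (rcons h v)) t && (j0 <= nsel c (nth [::] (rcons h v)) t)%N] =
  selfrom c j0 h.
  rewrite /selfrom (@eq_in_filter _ _ (fun t => selected c (nth [::] h) t && (j0 <= nsel c (nth [::] h) t)%N)).
    apply/eq_in_map => t; rewrite mem_filter mem_iota add0n => /and3P[_ _ th].
    by rewrite nth_rcons th.
  move=> t; rewrite mem_iota add0n => /andP[_ th].
  by rewrite /selected nsel_rcons ?(ltnW th) // nth_rcons th.
rewrite /selected nsel_rcons // nth_rcons ltnn eqxx -/(nselh c h).
by case: ifP => _; rewrite /= ?cats0 // nth_rcons ltnn eqxx cats1.
Qed.

(** The counter rises by at most one per sample, so it cannot skip the value [j]. *)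
Lemma nsel_attained c x t j : (j < nsel c x t)%N ->
  exists s, [/\ (s < t)%N, nsel c x s = j & selected c x s].
Proof.
elim: t => //= t IH; case: (ltnP j (nsel c x t)) => [/IH [s [st sj ss]] _|tj].
  by exists s; split=> //; exact: ltnW.
case: (boolP (in_threshold _ _ _)) => ss; last by rewrite addn0 ltnNge tj.
rewrite addn1 ltnS => jt; exists t; split=> //.
by apply/eqP; rewrite eqn_leq tj jt.
Qed.

Section Hits.
Context (c : nat -> int) (j0 m m' : nat).

Definition hits (h : seq node) : seq node :=
  [seq take m v | v <- selfrom c j0 h & (m' <= size v)%N].

Lemma hits_rcons h v : hits (rcons h v) =
  if [&& in_threshold c (nselh c h) v, (j0 <= nselh c h)%N & (m' <= size v)%N]
  then rcons (hits h) (take m v) else hits h.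
Proof.
rewrite /hits selfrom_rcons andbA; case: ifP => //= _.
by rewrite filter_rcons; case: ifP => //= _; rewrite map_rcons.
Qed.

(** With [j0 = n./2] this is the quantity Y. *)
Definition nhits (h : seq node) : nat := size (undup (hits h)).

Lemma nhits_rcons h v : nhits (rcons h v) =
  (nhits h + [&& in_threshold c (nselh c h) v, (j0 <= nselh c h)%N,
                 (m' <= size v)%N & take m v \notin hits h])%N.
Proof.
rewrite /nhits hits_rcons; case: (boolP (in_threshold _ _ _)) => _ /=; last by rewrite addn0.
case: (_ <= nselh _ _)%N => /=; last by rewrite addn0.
case: (_ <= size _)%N => /=; last by rewrite addn0.
have /perm_size -> : perm_eq (undup (rcons (hits h) (take m v))) (undup (take m v :: hits h)).
  by apply: perm_undup => u; rewrite mem_rcons.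
by rewrite /=; case: ifP => _ /=; rewrite ?addn0 ?addn1.
Qed.

End Hits.

(** * The weight *)

Section WeightFunction.
Context (R : realFieldType).
Implicit Types (M a : R) (y k : nat).

(* Solves rho w(y, k+1) >= (rho - nu) w(y, k) + nu w(y+1, k) when
   nu >= 2 a rho.  New hits are only guaranteed while y < M/2; from then on
   the constant 2/M dominates 1/y. *)
Definition weight M a y k : R :=
  2 / M + (if 2 * y%:R < M then (1 + y%:R + a * k%:R)^-1 else 0).

Lemma weight_ge0 M a y k : 0 < M -> 0 <= a -> 0 <= weight M a y k.
Proof.
move=> M0 a0; rewrite addr_ge0 ?divr_ge0 ?(ltW M0) //.
by case: ifP => // _; rewrite invr_ge0 !addr_ge0 ?mulr_ge0.
Qed.

Let den_gt0 a y k : 0 <= a -> 0 < 1 + y%:R + a * k%:R :> R.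
Proof. by move=> a0; rewrite ltr_wpDr ?mulr_ge0 // ltr_wpDr. Qed.

Lemma weight_anti M a y y' k : 0 < M -> 0 <= a -> (y <= y')%N ->
  weight M a y' k <= weight M a y k.
Proof.
move=> M0 a0 yy'; have yy'R : y%:R <= y'%:R :> R by rewrite ler_nat.
rewrite lerD2l; case: ifP => [y'M|_].
  rewrite ifT; last by apply: le_lt_trans y'M; rewrite ler_pM2l.
  by rewrite lef_pV2 ?posrE ?den_gt0 // lerD2r lerD2l.
by case: ifP => // _; rewrite invr_ge0 ltW ?den_gt0.
Qed.

(** One more [a <= 1] is added to a denominator that is at least 1. This supplies the factor 2
    allowed at a selection. *)
Lemma weight_succ M a y k : 0 < M -> 0 <= a <= 1 ->
  weight M a y k <= 2 * weight M a y k.+1.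
Proof.
move=> M0 /andP[a0 a1]; rewrite /weight mulrDr lerD //.
  by rewrite ler_peMl ?ler1n // divr_ge0 // ltW.
case: ifP => _; last by rewrite mulr0.
have := den_gt0 y k a0; have := den_gt0 y k.+1 a0; rewrite -natr1 => u0 v0.
rewrite -[leLHS]mul1r ler_pdivrMr // mulrAC ler_pdivlMr //.
have : 0 <= a * k%:R by rewrite mulr_ge0.
have : 0 <= y%:R :> R by [].
by move: (y%:R : R) (k%:R : R) => ? ? ? ?; lra.
Qed.

Lemma weight_step M a y k (rho nu : R) : 0 < M -> 0 <= a -> 0 <= rho ->
  nu <= rho -> 0 <= nu -> (2 * y%:R < M -> 2 * a * rho <= nu) ->
  (rho - nu) * weight M a y k + nu * weight M a y.+1 k
  <= rho * weight M a y k.+1.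
Proof.
move=> M0 a0 rho0 nurho nu0 nu_ge.
(* For [2 * y >= M] all weights involved equal [2 / M], and the inequality is an equality. *)
have [yM|yM] := boolP (2 * y%:R < M); last first.
  have y1M : (2 * y.+1%:R < M) = false.
    apply/negbTE; apply: contraNN yM; apply: le_lt_trans.
    by rewrite ler_pM2l // ler_nat.
  rewrite /weight y1M (negbTE yM) !addr0 -mulrDl.
  by rewrite subrK.
have {}nu_ge := nu_ge yM.
set u := 1 + y%:R + a * k%:R.
have u1 : 1 <= u by rewrite /u -addrA lerDl addr_ge0 // mulr_ge0.
have u0 : 0 < u by apply: lt_le_trans u1.
(* The hit may push [y.+1] past [M / 2], where the second summand is 0; the bound holds in both
   cases. *)
have w1 : weight M a y.+1 k <= 2 / M + (u + 1)^-1.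
  rewrite lerD2l; case: ifP => _; last by rewrite invr_ge0 addr_ge0 // ltW.
  by rewrite le_eqVlt; apply/orP; left; apply/eqP; congr _^-1; rewrite /u -natr1; ring.
have -> : weight M a y k = 2 / M + u^-1 by rewrite /weight yM.
have -> : weight M a y k.+1 = 2 / M + (u + a)^-1.
  by rewrite /weight yM; congr (_ + _^-1); rewrite /u -natr1; ring.
apply: (@le_trans _ _ ((rho - nu) * (2 / M + u^-1) + nu * (2 / M + (u + 1)^-1))).
  by rewrite lerD2l ler_wpM2l.
(* Clearing denominators leaves [a * rho * (u + 1) <= nu * (u + a)], which follows from
   [nu >= 2 * a * rho] and [u >= 1]. *)
suff : (rho - nu) * u^-1 + nu * (u + 1)^-1 <= rho * (u + a)^-1.
  by move: (2 / M) => z; lra.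
have u10 : 0 < u + 1 by rewrite addr_gt0.
have ua0 : 0 < u + a by rewrite ltr_wpDr.
have -> : (rho - nu) * u^-1 + nu * (u + 1)^-1 =
    (rho * (u + 1) - nu) / (u * (u + 1)).
  by field; rewrite !gt_eqF.
rewrite ler_pdivrMr ?mulr_gt0 // mulrAC ler_pdivlMr //.
have : 0 <= (nu - 2 * a * rho) * (u + a) by rewrite mulr_ge0 ?subr_ge0 // ltW.
have : 0 <= a * rho * (u - 1) by rewrite !mulr_ge0 // subr_ge0.
have : 0 <= a * rho * a by rewrite !mulr_ge0.
by clearbody u; nra.
Qed.

Lemma weight_end M a y : 0 < M -> (1 + y%:R)^-1 <= weight M a y 0.
Proof.
move=> M0; rewrite /weight mulr0 addr0.
case: ifPn => [_|]; first by rewrite lerDr divr_ge0 // ltW.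
rewrite -leNgt addr0 => My; have y0 : 0 < 1 + y%:R :> R by rewrite ltr_wpDr.
rewrite -[leLHS]mul1r ler_pdivrMr // mulrAC ler_pdivlMr // mul1r.
by apply: le_trans My _; rewrite ler_pM2l // lerDr.
Qed.

Lemma weight_start M a k : 0 < M -> M / 8 <= a * k%:R ->
  weight M a 0 k <= 10 / M.
Proof.
move=> M0 ak; rewrite /weight mulr0 M0 addr0.
have M80 : 0 < M / 8 by rewrite divr_gt0.
have -> : 10 / M = 2 / M + (M / 8)^-1 by field; rewrite gt_eqF.
rewrite lerD2l lef_pV2 ?posrE //; first by apply: le_trans ak _; rewrite lerDr.
by apply: lt_le_trans M80 (le_trans ak _); rewrite lerDr.
Qed.

End WeightFunction.

(** * The two covers as functions of the history *)

Definition copt n (h : seq node) : nat :=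
  \max_(S : {set 'I_(size h)} | #|S| == n)
    Defs.cover [seq nth [::] h (val i) | i in S].

Definition csel c (h : seq node) : nat := Defs.cover (selfrom c 0 h).

Lemma Cover_selE c x n : Cover_sel c x n = csel c (mkseq x (Tsel c x n)).
Proof.
rewrite /Cover_sel /csel /selfrom size_mkseq; move: (Tsel _ _ _) => t.
congr (Defs.cover _).
have E i : (i <= t)%N -> nsel c (nth [::] (mkseq x t)) i = nsel c x i.
  by move=> it; apply: nsel_ext => k ki; rewrite nth_mkseq ?(leq_trans ki).
rewrite [in RHS](@eq_in_filter _ _ (selected c x)).
  apply/eq_in_map => i; rewrite mem_filter mem_iota add0n => /and3P[_ _ it].
  by rewrite nth_mkseq.
move=> i; rewrite mem_iota add0n => /andP[_ it].
by rewrite /selected andbT E ?(ltnW it) // nth_mkseq.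
Qed.

Lemma Cover_optE c x n : Cover_opt c x n = copt n (mkseq x (Tsel c x n)).
Proof.
rewrite /Cover_opt /copt; move: (Tsel _ _ _) => t.
have xE i : (i < t)%N -> x i = nth [::] (mkseq x t) i by move=> it; rewrite nth_mkseq.
move: (mkseq x t) (size_mkseq x t) xE => h ht; subst t => xE.
apply: eq_bigr => S _; congr (Defs.cover _).
by apply: eq_map => i; exact: xE (ltn_ord i).
Qed.

(** A chosen node adds at most [m' - m] nodes of depths from [m] to below [m'], plus its nodes of
    depth at least [m']. Summing the latter over all of [h] gives a bound free of the choice of
    [S]. *)
Lemma copt_le m m' n h : (m <= m')%N ->
  (copt n h <= 2 ^ m + n * (m' - m) + \sum_(v <- h) ((size v).+1 - m'))%N.
Proof.
move=> mm'; apply/bigmax_leqP => S /eqP Sn.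
apply: leq_trans (Cover_le m _) _; rewrite -addnA leq_add2l big_image /=.
apply: (@leq_trans (\sum_(i in S) ((m' - m) + ((size (nth [::] h i)).+1 - m')))).
  by apply: leq_sum => i _; lia.
rewrite big_split /= sum_nat_const Sn leq_add2l.
rewrite (big_nth [::]) big_mkord [leqRHS](bigID (mem S)) /=.
exact: leq_addr.
Qed.

Lemma csel_ge c j0 m m' h : (m <= m')%N ->
  (nhits c j0 m m' h * (m' - m).+1 <= csel c h)%N.
Proof.
move=> mm'; apply: leq_trans (Cover_ge (selfrom c j0 h) mm') _.
rewrite /csel; apply: Cover_subset => v.
case/mapP => t; rewrite mem_filter => /andP[/andP[ts _] tr] ->.
by apply: map_f; rewrite mem_filter ts.
Qed.

(** The sample selected when the counter was [j] passed that threshold, and its own path is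
    covered. *)
Lemma csel_gt_depth c j h : (j < nselh c h)%N -> (depth_thr c j < csel c h)%N.
Proof.
move=> /nsel_attained[s [st sj ss]].
have : (size (nth [::] h s) < csel c h)%N.
  by apply: Cover_ge_size; apply: map_f; rewrite mem_filter ss mem_iota.
apply: leq_ltn_trans; rewrite -in_thresholdE -sj.
exact: ss.
Qed.

(** * Integrals at the selection time *)

Lemma first_selection_time c x n t : (n <= nsel c x t)%N ->
  exists tau, [/\ (tau <= t)%N, (n <= nsel c x tau)%N &
    forall s, (s < tau)%N -> (nsel c x s < n)%N].
Proof.
move=> nt; have ex : exists t, (n <= nsel c x t)%N by exists t.
case: (ex_minnP ex) => tau ntau min_tau; exists tau; split=> //.
  exact: min_tau.
by move=> s; apply: contraTltn => /min_tau; rewrite -leqNgt.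
Qed.

Lemma Tsel_first c x n tau : (n <= nsel c x tau)%N ->
  (forall s, (s < tau)%N -> (nsel c x s < n)%N) -> Tsel c x n = tau.
Proof.
move=> ntau lt_n; rewrite /Tsel; case: pselect => [ex|]; last by case; exists tau.
case: ex_minnP => t nt min_t; apply/eqP; rewrite eqn_leq min_t //=.
by rewrite leqNgt; apply/negP => /lt_n; rewrite ltnNge nt.
Qed.

Lemma Tsel_never c x n : (forall t, (nsel c x t < n)%N) -> Tsel c x n = 0%N.
Proof.
move=> lt_n; rewrite /Tsel; case: pselect => // -[t nt]; exfalso.
by move: nt; rewrite leqNgt lt_n.
Qed.

Lemma mkseq_Tsel c x n t : (n <= nsel c x t)%N ->
  mkseq x (Tsel c x n) = stopped c n (mkseq x t).
Proof.
move=> /first_selection_time[tau [taut ntau lt_n]].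
by rewrite (Tsel_first ntau lt_n) (stopped_mkseq_ge lt_n).
Qed.

Lemma nselh_stopped c x n t :
  (n <= nselh c (stopped c n (mkseq x t)))%N = (n <= nsel c x t)%N.
Proof.
case: (leqP n (nsel c x t)) => nt.
  have [tau [taut ntau lt_n]] := first_selection_time nt.
  by rewrite (stopped_mkseq_ge lt_n) // nselh_mkseq.
rewrite stopped_mkseq ?nselh_mkseq ?[LHS]leqNgt ?nt // => s /ltnW st.
exact: leq_ltn_trans (nsel_mono _ _ st) nt.
Qed.

Lemma size_stopped c x n t : (nsel c x t < n)%N ->
  size (stopped c n (mkseq x t)) = t.
Proof.
move=> nt; rewrite stopped_mkseq ?size_mkseq // => s /ltnW st.
exact: leq_ltn_trans (nsel_mono _ _ st) nt.
Qed.

Section AtSelectionTime.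
Context d (T : measurableType d) (R : realType) (P : probability T R).
Context (p : R) (x : nat -> T -> node) (c : nat -> int) (n : nat).
Hypothesis iid : iid_random_nodes P p x.

Definition done_part (F : seq node -> R) (h : seq node) : R :=
  if (n <= nselh c h)%N then F h else 0.

(** Monotone convergence: for each outcome the integrand is 0 before the [n]-th selection and
    constant afterwards. If that selection never happens, [Tsel] is 0 by convention and [F [::] = 0]
    makes both sides vanish. *)
Lemma integral_Tsel_cvg (F : seq node -> R) :
  F [::] = 0 -> (forall h, 0 <= F h) ->
  (\int[P]_w (done_part F (stopped c n (mkseq (x^~ w) t)))%:E)%E @[t --> \oo] -->
  (\int[P]_w (F (mkseq (x^~ w) (Tsel c (x^~ w) n)))%:E)%E.
Proof.
move=> Fnil F0.
pose g t w := (done_part F (stopped c n (mkseq (x^~ w) t)))%:E.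
have gE t w : g t w = if (n <= nsel c (x^~ w) t)%N
    then (F (mkseq (x^~ w) (Tsel c (x^~ w) n)))%:E else 0%:E.
  rewrite /g /done_part nselh_stopped; case: ifP => // nt.
  by rewrite (mkseq_Tsel nt).
have -> : (\int[P]_w (F (mkseq (x^~ w) (Tsel c (x^~ w) n)))%:E =
    \int[P]_w limn (g^~ w))%E.
  apply: eq_integral => w _.
  have [[t0 nt0]|never] := pselect (exists t, (n <= nsel c (x^~ w) t)%N).
    apply/esym/lim_near_cst => //; exists t0 => // t /= t0t.
    by rewrite gE (leq_trans nt0) // nsel_mono.
  have lt_n t : (nsel c (x^~ w) t < n)%N.
    by rewrite ltnNge; apply/negP => nt; apply: never; exists t.
  apply/esym/lim_near_cst => //; apply: nearW => t.
  by rewrite gE leqNgt lt_n (Tsel_never lt_n) /= Fnil.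
apply: (@cvg_monotone_convergence _ _ _ P setT measurableT g).
- move=> t.
  exact: (measurable_fun_fibers (fun h => (done_part F (stopped c n h))%:E) (measurable_hist iid t)).
- move=> t w _; rewrite gE; case: ifP => // _; rewrite lee_fin //.
- move=> w _ s t st; rewrite !gE; case: ifP => [ns|_].
    by rewrite (leq_trans ns) // nsel_mono.
  by case: ifP => // _; rewrite lee_fin.
Qed.

Lemma integral_Tsel_le (F q : seq node -> R) (kappa : \bar R) :
  F [::] = 0 -> (forall h, 0 <= F h) -> (forall h, 0 <= q h) ->
  (forall h, (n <= nselh c h)%N -> F h <= q h) ->
  (forall t, \int[P]_w (q (stopped c n (mkseq (x^~ w) t)))%:E <= kappa)%E ->
  (\int[P]_w (F (mkseq (x^~ w) (Tsel c (x^~ w) n)))%:E <= kappa)%E.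
Proof.
move=> Fnil F0 q0 Fq q_le; have cv := integral_Tsel_cvg Fnil F0.
rewrite -(cvg_lim _ cv) //; apply: lime_le; first exact: cvgP cv.
apply: nearW => t; apply: le_trans (q_le t).
have mh (f : seq node -> R) : measurable_fun [set: T] (fun w => (f (mkseq (x^~ w) t))%:E).
  exact: (measurable_fun_fibers (fun h => (f h)%:E) (measurable_hist iid t)).
have dq h : 0 <= done_part F h <= q h.
  by rewrite /done_part; case: ifP => nh; rewrite ?F0 ?Fq ?q0 ?lexx.
apply: ge0_le_integral => //.
- by move=> w _; rewrite lee_fin; case/andP: (dq (stopped c n (mkseq (x^~ w) t))).
- exact: (mh (fun h => done_part F (stopped c n h))).
- exact: (mh (fun h => q (stopped c n h))).
- by move=> w _; rewrite lee_fin; case/andP: (dq (stopped c n (mkseq (x^~ w) t))).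
Qed.

Lemma integral_Tsel_ge (F : seq node -> R) (kappa : \bar R) :
  F [::] = 0 -> (forall h, 0 <= F h) ->
  (\forall t \near \oo,
     kappa <= \int[P]_w (done_part F (stopped c n (mkseq (x^~ w) t)))%:E)%E ->
  (kappa <= \int[P]_w (F (mkseq (x^~ w) (Tsel c (x^~ w) n)))%:E)%E.
Proof.
move=> Fnil F0 F_ge; have cv := integral_Tsel_cvg Fnil F0.
by rewrite -(cvg_lim _ cv) //; apply: lime_ge => //; exact: cvgP cv.
Qed.

End AtSelectionTime.

(** * Bounds for a fixed number of selections *)

Lemma depth_thr_mono c : {homo c : i j / (i <= j)%N >-> i <= j} ->
  {homo depth_thr c : i j / (i <= j)%N}.
Proof.
move=> cmono i j ij; rewrite /depth_thr; case: eqP => // i0.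
case: eqP => j0; first by move: ij; rewrite j0 leqn0 => /eqP.
have := cmono _ _ ij.
by case: (leP 0 (c i - 1)); case: (leP 0 (c j - 1)) => ? ? ?; lia.
Qed.

(** The summand [depth_thr c 1] serves [n = 1], where [n./2] is 0 and the depth at index 0 is 0
    regardless of [c 0]. *)
Lemma depth_thr_half c K n : (forall i : nat, c i <= c i./2 + K) ->
  (depth_thr c n <= depth_thr c n./2 + (absz K + depth_thr c 1))%N.
Proof.
move=> cK; have := cK 0%N; have := cK n.
case: n => [|[|n]] cn c0; [by []|exact: leq_addl|].
rewrite addnA; apply: leq_trans (leq_addr _ _).
rewrite /depth_thr [n.+2./2]/= /=; move: cn; rewrite [n.+2./2]/=.
move: c0; rewrite [0./2]/= => c0.
by case: (leP 0 (c n.+2 - 1)); case: (leP 0 (c n./2.+1 - 1)) => ? ? ?; lia.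
Qed.

(** Take the largest [m] with the first inequality: [m = 0] satisfies it because the subtraction is
    truncated, and it forces [2 ^ m <= n], hence [m <= n]. *)
Lemma scale_exists (R : realFieldType) (r : R) (n E : nat) :
  0 < r < 1 -> (0 < n)%N ->
  exists m, 2 ^+ m <= n%:R * r ^+ (m - E) /\
            n%:R * r ^+ (m.+1 - E) < 2 ^+ m.+1.
Proof.
move=> /andP[r0 r1] n0.
pose Q m := 2 ^+ m <= n%:R * r ^+ (m - E).
have ex : exists m, Q m by exists 0%N; rewrite /Q sub0n !expr0 mulr1 ler1n.
have ub m : Q m -> (m <= n)%N.
  move=> Qm; have : 2 ^+ m <= n%:R :> R.
    by apply: le_trans Qm _; rewrite ler_piMr // exprn_ile1 ?ltW.
  rewrite -natrX ler_nat; apply: leq_trans.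
  exact/ltnW/ltn_expl.
case: (ex_maxnP ex ub) => m Qm max_m; exists m; split=> //.
by rewrite ltNge; apply/negP => /max_m; rewrite ltnn.
Qed.

Lemma scale_opt (R : realFieldType) (r : R) (n E m : nat) :
  n%:R * r ^+ (m.+1 - E) < 2 ^+ m.+1 ->
  (2 ^ m + n * (maxn m E - m) <= 2 * 2 ^ m * (maxn m E - m).+1)%N.
Proof.
case: (leqP E m) => [Em _|mE]; first by rewrite subnn; lia.
(* For [m < E] the exponent vanishes, so maximality of [m] reads [n < 2 ^ m.+1]. *)
have /eqP -> : (m.+1 - E)%N == 0%N by rewrite subn_eq0.
rewrite expr0 mulr1 -natrX ltr_nat expnS => n2.
rewrite mulnS leq_add ?leq_mul2r ?(ltnW n2) ?orbT //.
by rewrite mul2n -addnn leq_addr.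
Qed.

Lemma maxn_subr m E : (maxn m E - E = m - E)%N.
Proof. by lia. Qed.

Lemma maxn_subl_le m E : (maxn m E - m <= E)%N.
Proof. by lia. Qed.

Lemma maxn_le_add m E e : (E <= e)%N -> (maxn (maxn m E) e <= m - E + e)%N.
Proof. by lia. Qed.

Lemma subSn_le m E : (m.+1 - E <= (m - E).+1)%N.
Proof. by lia. Qed.

Lemma half_le_pred n : (0 < n)%N -> (n./2 <= n.-1)%N.
Proof. by lia. Qed.

Lemma leq_sub_half n : (n <= (n - n./2) * 2)%N.
Proof. by lia. Qed.

Section FixedSize.
Context d (T : measurableType d) (R : realType) (P : probability T R).
Context (p : R) (x : nat -> T -> node) (c : nat -> int) (n m Kd : nat).
Hypotheses (p0 : 0 < p) (p1 : p < 1).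
Hypothesis iid : iid_random_nodes P p x.
Hypothesis thr_mono : {homo depth_thr c : i j / (i <= j)%N}.
Hypothesis thr_half : (depth_thr c n <= depth_thr c n./2 + Kd)%N.
Hypothesis n0 : (0 < n)%N.

Let r := 1 - p.
Let E := depth_thr c n./2.
Let m' := maxn m E.
Let M : R := 2 ^+ m.
Let l := (m' - m).+1.

Hypothesis scale_le : M <= n%:R * r ^+ (m - E).
Hypothesis scale_lt : n%:R * r ^+ (m.+1 - E) < 2 ^+ m.+1.

Let r0 : 0 < r. Proof. by rewrite subr_gt0. Qed.
Let r1 : r < 1. Proof. by rewrite ltrBlDr ltrDl. Qed.
Let M0 : 0 < M. Proof. by rewrite exprn_gt0. Qed.
Let mm' : (m <= m')%N. Proof. exact: leq_maxl. Qed.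
Let m'E : (m' - E = m - E)%N. Proof. exact: maxn_subr. Qed.

Let Em' : (E <= m')%N. Proof. exact: leq_maxr. Qed.

Let b : R := r ^+ m' / p.
Let excess (v : node) : R := ((size v).+1 - m')%:R.
(** The quarter makes [2 * a] equal to half of [r ^+ (m - E)], the form in which the probability of
    a new hit is bounded below. *)
Let a : R := r ^+ (m - E) / 4.
(** The last argument is the number of selections left in the second half; it stays constant
    throughout the first half. *)
Let G (h : seq node) : R :=
  weight M a (nhits c n./2 m m' h) (n - maxn (nselh c h) n./2).

Let excess_ge0 v : 0 <= excess v. Proof. exact: ler0n. Qed.
Let a0 : 0 <= a. Proof. by rewrite divr_ge0 // exprn_ge0 // ltW. Qed.
Let a1 : a <= 1.
Proof.
rewrite ler_pdivrMr // mul1r; apply: (@le_trans _ _ 1); last by rewrite ler1n.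
by rewrite exprn_ile1 // ltW.
Qed.

Let G0 h : 0 <= G h. Proof. exact: weight_ge0. Qed.

Let G_unsel h v : (nselh c h < n)%N ->
  ~~ in_threshold c (nselh c h) v -> G (rcons h v) <= G h.
Proof.
by move=> _ nsel; rewrite /G nhits_rcons nselh_rcons (negbTE nsel) /= !addn0.
Qed.

Let G_sel h v : (nselh c h < n)%N ->
  in_threshold c (nselh c h) v -> G (rcons h v) <= 2 * G h.
Proof.
move=> hn sv; rewrite /G nhits_rcons nselh_rcons sv addn1.
apply: le_trans (weight_anti _ M0 a0 (leq_addr _ _)) _.
case: (leqP n./2 (nselh c h)) => jn.
  rewrite ?(maxn_idPl jn) (maxn_idPl (leqW jn)) -[X in _ <= 2 * weight _ _ _ X](subnSK hn).
  by rewrite weight_succ // a0.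
rewrite (maxn_idPr jn) ?(maxn_idPr (ltnW jn)) ler_peMl ?ler1n //.
exact: weight_ge0.
Qed.

Let mQ t (Q : node -> Prop) : measurable [set w | Q (x t w)].
Proof.
have [mx _ _] := iid.
exact: (measurable_fibers_preimage [set v | Q v] (mx t)).
Qed.

Let prob_bool t (Q : pred node) :
  (\int[P]_w ((Q (x t w))%:R : R)%:E = P [set w | Q (x t w)])%E.
Proof.
rewrite -[X in _ = P X]setIT -integral_indic //; last exact: (mQ t Q).
by apply: eq_integral => w _; rewrite indicE /= mem_setE.
Qed.

Let prob_sel t j : P [set w | in_threshold c j (x t w)] = (r ^+ depth_thr c j)%:E.
Proof.
have [mx lawx _] := iid.
rewrite -(prob_size_ge (mx t) (lawx t)); congr (P _).
by apply/seteqP; split=> w /=; rewrite in_thresholdE.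
Qed.

Let new_hit h j v := [&& in_threshold c j v, (m' <= size v)%N & take m v \notin hits c n./2 m m' h].

(** While fewer than half of the [M] nodes of depth [m] are hit, at least half of the mass at depths
    from [maxn m' (depth_thr c j)] on gives a new hit. That depth is at most
    [m - E + depth_thr c j], since [E <= depth_thr c j] in the second half. *)
Let prob_new_hit h t j : (n./2 <= j)%N -> 2 * (nhits c n./2 m m' h)%:R < M ->
  ((2 * a * r ^+ depth_thr c j)%:E <= P [set w | new_hit h j (x t w)])%E.
Proof.
move=> jn yM; have [mx lawx _] := iid.
set y := nhits c n./2 m m' h in yM *.
have mk : (m <= maxn m' (depth_thr c j))%N by rewrite leq_max mm'.
have := prob_prefix_notin_ge p0 p1 (mx t) (lawx t) (undup (hits c n./2 m m' h)) mk.
rewrite (_ : mkset _ = [set w | new_hit h j (x t w)]); last first.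
  apply/seteqP; split=> w /=; rewrite /new_hit in_thresholdE geq_max mem_undup.
    by move=> [/andP[-> ->] ->].
  by move=> /and3P[-> -> ->].
apply: le_trans; rewrite lee_fin -/r -[size _]/y -/M.
have half : 1 / 2 <= 1 - y%:R / M.
  rewrite lerBrDr -lerBrDl ler_pdivrMr // (_ : 1 - 1 / 2 = 2^-1); last by field.
  by rewrite mulrC ler_pdivlMr // mulrC ltW.
apply: (@le_trans _ _ (1 / 2 * r ^+ maxn m' (depth_thr c j))); last first.
  by rewrite ler_wpM2r // exprn_ge0 // ltW.
rewrite (_ : 2 * a * _ = 1 / 2 * r ^+ (m - E + depth_thr c j)); last first.
  by rewrite /a exprD; field.
rewrite ler_wpM2l // ler_wiXn2l ?(ltW r0) ?(ltW r1) //.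
exact: maxn_le_add (thr_mono jn).
Qed.

Let G_step h t : (nselh c h < n)%N ->
  (\int[P]_w ((in_threshold c (nselh c h) (x t w))%:R * G (rcons h (x t w)))%:E
   <= ((1 - p) ^+ depth_thr c (nselh c h) * G h)%:E)%E.
Proof.
move=> hn; have [mx lawx _] := iid; set j := nselh c h in hn *.
set y := nhits c n./2 m m' h.
have mF (f : node -> \bar R) : measurable_fun [set: T] (fun w => f (x t w)).
  exact: (measurable_fun_fibers f (mx t)).
rewrite -/r; set rho := r ^+ _.
have rho0 : 0 <= rho by rewrite exprn_ge0 // ltW.
have GE : G h = weight M a y (n - maxn j n./2) by [].
have GrE v : in_threshold c j v -> G (rcons h v) =
    weight M a (y + ((n./2 <= j)%N && new_hit h j v)) (n - maxn j.+1 n./2).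
  move=> sv; rewrite /G nhits_rcons nselh_rcons -/j /new_hit sv addn1 /=.
  by rewrite -/y.
(* In the first half no hit is counted and a selection leaves [G] unchanged, so the claim reduces to
   the probability of selection. *)
case: (leqP n./2 j) => jn; last first.
  rewrite (eq_integral (fun w => (G h)%:E * ((in_threshold c j (x t w))%:R)%:E)%E); last first.
    move=> w _; rewrite -EFinM mulrC; congr EFin.
    case: (boolP (in_threshold c j (x t w))) => sv; last by rewrite !mulr0.
    rewrite (GrE _ sv) leqNgt jn /= addn0 GE.
    by rewrite (maxn_idPr jn) ?(maxn_idPr (ltnW jn)).
  rewrite ge0_integralZl_EFin //; last exact: (mF (fun v => ((in_threshold c j v)%:R)%:E)).
  by rewrite prob_bool prob_sel -EFinM mulrC.
set k := (n - j.+1)%N.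
have knj : (n - j)%N = k.+1 by rewrite -subSn.
(* Selections split into new hits, of probability [nu], and the others, of probability [rho - nu],
   as in [weight_step]. *)
pose B1 v := in_threshold c j v && ~~ new_hit h j v.
rewrite (eq_integral (fun w => (weight M a y k)%:E * ((B1 (x t w))%:R)%:E +
   (weight M a y.+1 k)%:E * ((new_hit h j (x t w))%:R)%:E)%E); last first.
  move=> w _; rewrite -!EFinM -EFinD; congr EFin; rewrite /B1.
  case: (boolP (in_threshold c j (x t w))) => sv; last first.
    by rewrite /new_hit (negbTE sv) /= mul0r !mulr0 addr0.
  rewrite (GrE _ sv) jn (maxn_idPl (leqW jn)) -/k mul1r.
  by case: (new_hit _ _ _); rewrite /= ?addn1 ?addn0 ?mulr1 ?mulr0 ?addr0 ?add0r.
have w0 y' : 0 <= weight M a y' k by exact: weight_ge0.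
rewrite ge0_integralD //; last first.
- exact: (mF (fun v => (weight M a y.+1 k)%:E * ((new_hit h j v)%:R)%:E)%E).
- by move=> w _; rewrite -EFinM lee_fin mulr_ge0.
- exact: (mF (fun v => (weight M a y k)%:E * ((B1 v)%:R)%:E)%E).
- by move=> w _; rewrite -EFinM lee_fin mulr_ge0.
have mB1 : measurable_fun [set: T] (fun w => (((B1 (x t w))%:R : R))%:E).
  exact: (mF (fun v => ((B1 v)%:R)%:E)).
have mN : measurable_fun [set: T] (fun w => (((new_hit h j (x t w))%:R : R))%:E).
  exact: (mF (fun v => ((new_hit h j v)%:R)%:E)).
rewrite (ge0_integralZl_EFin _ _ _ mB1) // (ge0_integralZl_EFin _ _ _ mN) //.
rewrite !prob_bool.
set nu := P [set w | new_hit h j (x t w)].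
have nuE : nu = (fine nu)%:E.
  by rewrite fineK // fin_num_measure //; exact: (mQ t (new_hit h j)).
have split_sel : (P [set w | B1 (x t w)] + nu = rho%:E)%E.
  rewrite /rho -(prob_sel t) -(@measureU _ _ _ P); last first.
  - by apply/seteqP; split=> // w /= [/andP[_ /negP]].
  - exact: (mQ t (new_hit h j)).
  - exact: (mQ t B1).
  congr (P _); apply/seteqP; split=> w /=; rewrite /B1 /new_hit.
    by move=> [/andP[]|/and3P[]].
  by case: (in_threshold _ _ _) => //= _; case: (_ && _); [right|left].
have B1E : P [set w | B1 (x t w)] = (rho - fine nu)%:E.
  by rewrite EFinB -split_sel -nuE addeK // nuE.
have nu_ge0 : 0 <= fine nu by rewrite -lee_fin -nuE measure_ge0.
have nu_le : fine nu <= rho.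
  by rewrite -subr_ge0 -lee_fin -B1E measure_ge0.
rewrite B1E nuE -!EFinM -EFinD lee_fin GE (maxn_idPl jn) knj.
rewrite [leLHS](_ : _ = (rho - fine nu) * weight M a y k + fine nu * weight M a y.+1 k); last by ring.
apply: weight_step => // yM.
by rewrite -lee_fin -nuE; exact: prob_new_hit.
Qed.

Let C0 : R := 4 / (p * r ^+ Kd.+1).
Let C3 : R := 10 * (1 + C0).

Let C0_ge0 : 0 <= C0. Proof. by rewrite divr_ge0 // mulr_ge0 ?exprn_ge0 // ltW. Qed.
Let C3_gt0 : 0 < C3. Proof. by rewrite mulr_gt0 // ltr_wpDr. Qed.
Let b_ge0 : 0 <= b. Proof. by rewrite divr_ge0 ?exprn_ge0 // ltW. Qed.

(** Every threshold depth involved is at most [E + Kd], so the reserve is at most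
    [2 * n * r ^+ (m - E) / (p * r ^+ Kd)]; maximality of [m] gives [n * r ^+ (m - E) * r <= 2 * M].
    Hence the 4 and the exponent [Kd.+1] in [C0]. *)
Let reserve_le : reserve p c n b 0 <= C0 * M.
Proof.
have term i : (i < n)%N -> b / r ^+ depth_thr c i <= r ^+ (m - E) / (p * r ^+ Kd).
  move=> i_n; have -> : r ^+ (m - E) / (p * r ^+ Kd) = b / r ^+ (E + Kd).
    have -> : b = r ^+ E * r ^+ (m - E) / p by rewrite /b -exprD -m'E subnKC.
    by rewrite exprD; field; rewrite !gt_eqF ?exprn_gt0.
  rewrite ler_wpM2l // lef_pV2 ?posrE ?exprn_gt0 // ler_wiXn2l ?(ltW r0) ?(ltW r1) //.
  exact: leq_trans (thr_mono (ltnW i_n)) thr_half.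
have sum_le : \sum_(0 <= i < n) b / r ^+ depth_thr c i <=
    n%:R * (r ^+ (m - E) / (p * r ^+ Kd)).
  rewrite -[n in n%:R]subn0 mulr_natl -sumr_const_nat big_nat [leRHS]big_nat.
  by apply: ler_sum => i /andP[_ /term].
have rM : n%:R * r ^+ (m - E) * r <= 2 * M.
  rewrite -exprS; apply: le_trans (ltW scale_lt).
  rewrite -mulrA ler_wpM2l // -exprSr ler_wiXn2l ?(ltW r0) ?(ltW r1) //.
  exact: subSn_le.
apply: le_trans (ler_wpM2l _ sum_le) _ => //.
have -> : 2 * (n%:R * (r ^+ (m - E) / (p * r ^+ Kd))) =
    2 / (p * r ^+ Kd.+1) * (n%:R * r ^+ (m - E) * r).
  by rewrite exprS; field; rewrite !gt_eqF ?exprn_gt0.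
apply: le_trans (ler_wpM2l _ rM) _; last first.
  by rewrite /C0 le_eqVlt; apply/orP; left; apply/eqP; ring.
by rewrite divr_ge0 // mulr_ge0 ?exprn_ge0 // ltW.
Qed.

Let excess_le t : (\int[P]_w (excess (x t w))%:E <= b%:E)%E.
Proof. by have [mx lawx _] := iid; exact: integral_depth_excess. Qed.

Let W := potential p c n M b excess G.

Let W_ge0 h : 0 <= W h.
Proof. by apply: potential_ge0 => //; exact: ltW. Qed.

(** At least half of the [n] selections lie in the second half, so [a] times their number is at
    least [M / 8] and [G] starts below [10 / M]; the other factor is at most [(1 + C0) * M]. *)
Let W_start : W [::] <= C3.
Proof.
rewrite /W /potential big_nil addr0 [nselh _ _]/=.
apply: (@le_trans _ _ ((M + C0 * M) * (10 / M))); last first.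
  by rewrite /C3 le_eqVlt; apply/orP; left; apply/eqP; field; rewrite gt_eqF.
apply: ler_pM => //.
- by rewrite addr_ge0 ?(ltW M0) ?(reserve_ge0 c n p1 b_ge0).
- by rewrite lerD2l.
apply: weight_start => //; rewrite max0n.
apply: (@le_trans _ _ (n%:R * r ^+ (m - E) / 8)); first by rewrite ler_pM2r // invr_gt0.
have -> : n%:R * r ^+ (m - E) / 8 = r ^+ (m - E) / 4 * (n%:R / 2) by field.
rewrite /a ler_wpM2l // ler_pdivrMr // -natrM ler_nat.
exact: leq_sub_half.
Qed.

Let W_le t : (\int[P]_w (W (stopped c n (mkseq (x^~ w) t)))%:E <= C3%:E)%E.
Proof.
have := integral_potential_le p1 iid (ltW M0) b_ge0 excess_ge0 G0
  excess_le G_unsel G_sel G_step t.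
by move=> /le_trans; apply; rewrite lee_fin W_start.
Qed.

Let unit_step h t : (nselh c h < n)%N ->
  (\int[P]_w ((in_threshold c (nselh c h) (x t w))%:R * 1 : R)%:E
   <= ((1 - p) ^+ depth_thr c (nselh c h) * 1)%:E)%E.
Proof.
move=> _; under eq_integral do rewrite mulr1.
by rewrite prob_bool prob_sel mulr1.
Qed.

(** A Wald-type bound, from the potential with [M0 = 0] and [G = 1]. It is applied to [excess], and
    to the constant 1 to bound the mean number of samples drawn. *)
Let additive_le (b' : R) (inc : node -> R) t : 0 <= b' -> (forall v, 0 <= inc v) ->
  (forall t, \int[P]_w (inc (x t w))%:E <= b'%:E)%E ->
  (\int[P]_w (\sum_(v <- stopped c n (mkseq (x^~ w) t)) inc v)%:E
   <= (reserve p c n b' 0)%:E)%E.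
Proof.
move=> b'0 inc0 inc_le; have one_le2 : 1 <= 2 * 1 :> R by rewrite mulr1 ler1n.
have := integral_potential_le p1 iid (lexx 0) b'0 inc0 (fun=> ler01) inc_le
  (fun _ _ _ _ => lexx 1) (fun _ _ _ _ => one_le2) unit_step t.
rewrite /potential big_nil !add0r mulr1 [nselh _ _]/= => H.
apply: le_trans H; apply: ge0_le_integral => //.
- by move=> w _; rewrite lee_fin sumr_ge0.
- exact: (measurable_fun_fibers (fun h => (\sum_(v <- stopped c n h) inc v)%:E) (measurable_hist iid t)).
- exact: (measurable_fun_fibers (fun h => ((0 + \sum_(v <- stopped c n h) inc v + reserve p c n b' (nselh c (stopped c n h))) * 1)%:E) (measurable_hist iid t)).
- by move=> w _; rewrite lee_fin mulr1 add0r lerDl reserve_ge0.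
Qed.

Let y h := nhits c n./2 m m' h.

(** The hits give [y h * l]. One more [l <= E.+1] comes from the path of the last selected sample,
    whose threshold index [n.-1] is at least [n./2]. *)
Let csel_lower h : (n <= nselh c h)%N -> ((1 + y h) * l <= 2 * csel c h)%N.
Proof.
move=> nh; rewrite mulnDl mul1n mul2n -addnn leq_add ?csel_ge //.
have := @csel_gt_depth c n.-1 h; rewrite prednK // => /(_ nh); apply: leq_trans.
rewrite ltnS; apply: (@leq_trans E); first exact: maxn_subl_le.
exact/thr_mono/half_le_pred.
Qed.

Let W_lower h : (n <= nselh c h)%N ->
  (M + \sum_(v <- h) excess v) / (1 + (y h)%:R) <= W h.
Proof.
move=> nh; have S0 : 0 <= \sum_(v <- h) excess v by exact: sumr_ge0.
apply: ler_pM => //.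
- by rewrite addr_ge0 // ltW.
- by rewrite lerDl reserve_ge0.
rewrite /G; have /eqP -> : (n - maxn (nselh c h) n./2 == 0)%N by rewrite subn_eq0 leq_max nh.
exact: weight_end.
Qed.

Let copt_upper h :
  (copt n h)%:R <= 2 * M * l%:R + \sum_(v <- h) excess v :> R.
Proof.
have := leq_trans (copt_le n h mm') (leq_add (scale_opt scale_lt) (leqnn _)).
by rewrite -(ler_nat R) natrD !natrM natrX natr_sum.
Qed.

Let copt0 : copt n [::] = 0%N.
Proof.
apply/eqP; rewrite -leqn0; apply/bigmax_leqP => S /eqP Sn.
by move: n0; rewrite -Sn ltnNge (leq_trans (max_card _)) // card_ord.
Qed.

Lemma ratio_le :
  (\int[P]_w ((Cover_opt c (x^~ w) n)%:R / (Cover_sel c (x^~ w) n)%:R : R)%:E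
   <= (4 * C3)%:E)%E.
Proof.
under eq_integral do rewrite Cover_selE Cover_optE.
apply: (integral_Tsel_le iid (F := fun h => (copt n h)%:R / (csel c h)%:R)
  (q := fun h => 4 * W h)) => //.
- by rewrite copt0 mul0r.
- by move=> h; rewrite mulr_ge0.
(* With B the total excess, the ratio is at most [2 * M * l + B] over [(1 + y h) * l / 2]; as
   [l >= 1], this is at most [4 * (M + B) / (1 + y h)]. *)
- move=> h nh; apply: le_trans (ler_wpM2l _ (W_lower nh)) => //.
  have := csel_lower nh; rewrite -(ler_nat R) !natrM natrD => cl.
  have S0 : 0 <= \sum_(v <- h) excess v by exact: sumr_ge0.
  have l1 : 1 <= l%:R :> R by rewrite ler1n.
  have u1 : 0 < 1 + (y h)%:R :> R by rewrite ltr_wpDr.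
  have l0 : 0 < l%:R :> R by rewrite ltr0n.
  have cs0 : 0 < (csel c h)%:R :> R.
    by rewrite -(pmulr_rgt0 _ (ltr0n R 2)); apply: lt_le_trans cl; rewrite mulr_gt0.
  rewrite ler_pdivrMr //; apply: le_trans (copt_upper h) _.
  rewrite -ler_pdivrMl ?divr_gt0 ?mulr_gt0 //; last by rewrite ltr_wpDr.
  apply: (@le_trans _ _ ((1 + (y h)%:R) * l%:R / 2)); last first.
    by rewrite ler_pdivrMr // [leRHS]mulrC.
  rewrite mulrC ler_pdivrMr ?divr_gt0 ?mulr_gt0 //; last by rewrite ltr_wpDr.
  rewrite (_ : _ * (4 * _) = 2 * M * l%:R + 2 * l%:R * \sum_(v <- h) excess v); last first.
    by field; rewrite gt_eqF.
  rewrite lerD2l ler_peMl // -[leLHS]mulr1 ler_pM //; exact: ler1n.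
- move=> t /=; under eq_integral do rewrite EFinM.
  rewrite ge0_integralZl_EFin //; first last.
  + exact: (measurable_fun_fibers (fun h => (W (stopped c n h))%:E) (measurable_hist iid t)).
  + by move=> w _; rewrite lee_fin.
  by rewrite [leRHS]EFinM lee_wpmul2l ?lee_fin.
Qed.

Lemma opt_le :
  (\int[P]_w ((Cover_opt c (x^~ w) n)%:R : R)%:E <= ((2 + C0) * (M * l%:R))%:E)%E.
Proof.
under eq_integral do rewrite Cover_optE.
have l1 : 1 <= l%:R :> R by rewrite ler1n.
apply: (integral_Tsel_le iid (F := fun h => (copt n h)%:R)
  (q := fun h => 2 * M * l%:R + \sum_(v <- h) excess v)) => //.
- by rewrite copt0.
- by move=> h; rewrite addr_ge0 ?sumr_ge0 // !mulr_ge0 // ltW.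
move=> t /=; under eq_integral do rewrite EFinD.
rewrite ge0_integralD //; first last.
- exact: (measurable_fun_fibers (fun h => (\sum_(v <- stopped c n h) excess v)%:E) (measurable_hist iid t)).
- by move=> w _; rewrite lee_fin sumr_ge0.
- by move=> w _; rewrite lee_fin !mulr_ge0 // ltW.
rewrite integral_prob_cst.
apply: (le_trans (leeD2l _ (additive_le t b_ge0 excess_ge0 excess_le))).
rewrite -EFinD lee_fin [leRHS](mulrDl 2 C0) -(mulrA 2 M) lerD2l; apply: le_trans reserve_le _.
by rewrite ler_wpM2l // ler_peMr // ltW.
Qed.

Lemma sel_ge :
  ((M * l%:R / (4 * C3))%:E <= \int[P]_w ((Cover_sel c (x^~ w) n)%:R : R)%:E)%E.
Proof.
under eq_integral do rewrite Cover_selE.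
apply: (integral_Tsel_ge iid (F := fun h => (csel c h)%:R)) => //.
set kappa := reserve p c n 1 0.
have k0 : 0 <= kappa by apply: reserve_ge0.
near=> t.
(* This makes unfinished histories cost at most [X / 4] below. The [W] term costs [X / 2], and the
   remaining [X / 4] is the stated lower bound. *)
have t4 : 4 * kappa <= t%:R.
  near: t; exists (Num.bound (4 * kappa)) => // t /= kt.
  apply/ltW/(lt_le_trans (archi_boundP _)); first by rewrite mulr_ge0.
  by rewrite ler_nat.
have t0 : 0 < t%:R :> R by rewrite ltr0n; near: t; exists 1%N.
have sz_le : (\int[P]_w ((size (stopped c n (mkseq (x^~ w) t)))%:R : R)%:E <= kappa%:E)%E.
  have sumE (s : seq node) : \sum_(v <- s) 1 = (size s)%:R :> R.
    by rewrite big_const_seq count_predT iter_addr_0.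
  under eq_integral do rewrite -sumE.
  apply: (additive_le t ler01 (fun=> ler01)) => t'.
  by rewrite [leLHS](integral_prob_cst P 1%:E).
pose X : R := M * l%:R / C3.
have X0 : 0 <= X by rewrite !mulr_ge0 ?invr_ge0 ?(ltW M0) ?(ltW C3_gt0).
have XC0 : 0 <= X / 2 / C3.
  by apply: divr_ge0; [apply: divr_ge0|exact: ltW].
pose f1 h : R := done_part c n (fun h => (csel c h)%:R) h.
have f10 h : 0 <= f1 h by rewrite /f1 /done_part; case: ifP.
(* If T_n <= t this is u + v^2 / u >= 2 v for u = (1 + Y) l / 2 and
   v = X / 2; otherwise the stopped history has length t, an unlikely event
   because its mean length is at most kappa. *)
have pt w : X <= f1 (stopped c n (mkseq (x^~ w) t)) +
    (X / 2 / C3 * W (stopped c n (mkseq (x^~ w) t)) +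
     X / t%:R * (size (stopped c n (mkseq (x^~ w) t)))%:R).
  set h := stopped _ _ _.
  have [nh|nh] := leqP n (nselh c h); last first.
    have -> : size h = t.
      by apply: size_stopped; move: nh; rewrite !ltnNge nselh_stopped.
    by rewrite divfK ?gt_eqF // addrA lerDr addr_ge0 // mulr_ge0 // XC0.
  rewrite addrA; apply: (@le_trans _ _ (f1 h + X / 2 / C3 * W h)); last first.
    by rewrite lerDl mulr_ge0 // divr_ge0.
  have := csel_lower nh; rewrite -(ler_nat R) !natrM natrD => cl.
  have u0 : 0 < 1 + (y h)%:R :> R by rewrite ltr_wpDr.
  have S0 : 0 <= \sum_(v <- h) excess v by exact: sumr_ge0.
  have Wl : M / (1 + (y h)%:R) <= W h.
    apply: le_trans (W_lower nh); rewrite ler_wpM2r ?invr_ge0 ?(ltW u0) //.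
    by rewrite lerDl.
  rewrite /f1 /done_part nh.
  apply: (@le_trans _ _ ((1 + (y h)%:R) * l%:R / 2 +
      X / 2 / C3 * (M / (1 + (y h)%:R)))); last first.
    apply: lerD; first by rewrite ler_pdivrMr // [leRHS]mulrC.
    by rewrite ler_wpM2l.
  rewrite -subr_ge0.
  rewrite (_ : _ - X = l%:R / (2 * (1 + (y h)%:R)) * ((1 + (y h)%:R) - M / C3) ^+ 2); last first.
    by rewrite /X; field; rewrite !gt_eqF.
  by rewrite mulr_ge0 ?sqr_ge0 // divr_ge0 // mulr_ge0 // ltW.
have mh (f : seq node -> R) : measurable_fun [set: T] (fun w => (f (mkseq (x^~ w) t))%:E).
  exact: (measurable_fun_fibers (fun h => (f h)%:E) (measurable_hist iid t)).
have mW := mh (fun h => W (stopped c n h)).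
have mf1 := mh (fun h => f1 (stopped c n h)).
have msz := mh (fun h => (size (stopped c n h))%:R).
have Xt0 : 0 <= X / t%:R by rewrite divr_ge0.
have : (X%:E <= \int[P]_w ((f1 (stopped c n (mkseq (x^~ w) t)))%:E +
    ((X / 2 / C3)%:E * (W (stopped c n (mkseq (x^~ w) t)))%:E +
     (X / t%:R)%:E * ((size (stopped c n (mkseq (x^~ w) t)))%:R)%:E)))%E.
  rewrite -[leLHS](integral_prob_cst P); apply: ge0_le_integral => //.
  - exact: (mh (fun h => f1 (stopped c n h) + (X / 2 / C3 * W (stopped c n h) +
      X / t%:R * (size (stopped c n h))%:R))).
  - by move=> w _; rewrite -!EFinM -!EFinD lee_fin.
rewrite ge0_integralD //; first last.
- exact: (mh (fun h => X / 2 / C3 * W (stopped c n h) + X / t%:R * (size (stopped c n h))%:R)).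
- by move=> w _; rewrite -!EFinM -EFinD lee_fin; apply: addr_ge0; apply: mulr_ge0.
- by move=> w _; rewrite lee_fin.
rewrite ge0_integralD //; first last.
- exact: (mh (fun h => X / t%:R * (size (stopped c n h))%:R)).
- by move=> w _; rewrite -EFinM lee_fin; apply: mulr_ge0.
- exact: (mh (fun h => X / 2 / C3 * W (stopped c n h))).
- by move=> w _; rewrite -EFinM lee_fin; apply: mulr_ge0.
rewrite (ge0_integralZl_EFin _ _ _ mW) //; last by move=> w _; rewrite lee_fin.
rewrite (ge0_integralZl_EFin _ _ _ msz) // => bound.
have {}bound := le_trans bound (leeD2l _ (leeD
  (lee_wpmul2l (x := (X / 2 / C3)%:E) _ (W_le t))
  (lee_wpmul2l (x := (X / t%:R)%:E) _ sz_le))).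
rewrite !lee_fin in bound; have {}bound := bound XC0 Xt0.
rewrite -!EFinM -EFinD -leeBlDr // -EFinB in bound.
apply: le_trans bound; rewrite lee_fin.
have -> : M * l%:R / (4 * C3) = X / 4 by rewrite /X; field; rewrite gt_eqF.
have -> : X / 2 / C3 * C3 = X / 2 by rewrite divfK // gt_eqF.
have : X / t%:R * kappa <= X / 4.
  rewrite -mulrA ler_wpM2l // mulrC ler_pdivrMr // mulrC ler_pdivlMr //.
  by rewrite mulrC.
move: (X / t%:R * kappa) => z zX.
rewrite opprD addrA lerBrDr; apply: le_trans (lerD (lexx _) zX) _.
by rewrite le_eqVlt; apply/orP; left; apply/eqP; field.
Unshelve. all: by end_near. Qed.

Lemma opt_le_sel :
  (\int[P]_w ((Cover_opt c (x^~ w) n)%:R : R)%:E <=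
   (4 * C3 * (2 + C0))%:E * \int[P]_w ((Cover_sel c (x^~ w) n)%:R : R)%:E)%E.
Proof.
apply: le_trans opt_le _.
have k0 : 0 <= 4 * C3 * (2 + C0) by rewrite !mulr_ge0 ?addr_ge0 // ltW.
have := lee_wpmul2l (x := (4 * C3 * (2 + C0))%:E) _ sel_ge.
rewrite lee_fin => /(_ k0); apply: le_trans.
rewrite -EFinM lee_fin le_eqVlt; apply/orP; left; apply/eqP; field.
by rewrite gt_eqF.
Qed.

End FixedSize.

Theorem theorem6 (d : measure_display) (T : measurableType d) (R : realType)
    (P : probability T R) (p : R) (x : nat -> T -> node)
    (c : nat -> int) (K : int) :
  0 < p < 1 ->
  iid_random_nodes P p x ->
  {homo c : i j / (i <= j)%N >-> i <= j} ->
  (forall i : nat, c i <= c i./2 + K) ->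
  (exists C : R, forall n : nat, (0 < n)%N ->
     (\int[P]_(w in setT)
        ((Cover_opt c (x^~ w) n)%:R / (Cover_sel c (x^~ w) n)%:R : R)%:E
      <= C%:E)%E)
  /\
  (exists C : R, forall n : nat, (0 < n)%N ->
     (\int[P]_(w in setT) ((Cover_opt c (x^~ w) n)%:R : R)%:E
      <= C%:E * \int[P]_(w in setT) ((Cover_sel c (x^~ w) n)%:R : R)%:E)%E).
Proof.
move=> /andP[p0 p1] iid c_mono c_half.
have thr_mono := depth_thr_mono c_mono.
have r01 : 0 < 1 - p < 1 by rewrite subr_gt0 p1 ltrBlDr ltrDl.
(* The constants involve only [p] and [absz K + depth_thr c 1], so they can be fixed before [n] and
   its scale [m]. *)
split; eexists => n n0;
  have [m [scale_le scale_lt]] := scale_exists (depth_thr c n./2) r01 n0.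
  exact: (ratio_le p0 p1 iid thr_mono (depth_thr_half n c_half) n0 scale_le scale_lt).
exact: (opt_le_sel p0 p1 iid thr_mono (depth_thr_half n c_half) n0 scale_le scale_lt).
Qed.
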